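(* Let $R$ be a ring that is semilocal or $\mathbb{Q}$-finite, let $C=\mathrm{Cent}(R)$ and let $\sigma\in\mathrm{Aut}(C)$. Then $R$ is Morita equivalent over $C$ to a (central) $C$-algebra with an anti-automorphism of type $\sigma$ if and only if $R$ is Morita equivalent to $R^{\mathrm{op}}$ (as rings) via a Morita equivalence of type $\sigma$.
   Context: Rings are unital. $R$ is semilocal if $R/\mathrm{Jac}(R)$ is semisimple artinian, where $\mathrm{Jac}(R)$ is the Jacobson radical. $R$ is $\mathbb{Q}$-finite if both $\dim_{\mathbb{Q}}(R\otimes_{\mathbb{Z}}\mathbb{Q})$ and the cardinality of $\ker(R\to R\otimes_{\mathbb{Z}}\mathbb{Q})$ are finite. A right $R$-progenerator is a finitely generated projective right $R$-module that is a generator. An $(S,R)$-progenerator is an $(S,R)$-bimodule $P$ such that $P_R$ is a progenerator and every endomorphism of $P_R$ has the form $p\mapsto sp$ for a unique $s\in S$. Equivalences $\mathrm{Mod}\text{-}S\to\mathrm{Mod}\text{-}R$ are, up to natural isomorphism, the functors $(-)\otimes_S P$ with $P$ an $(S,R)$-progenerator. Let $C$ be a commutative ring and $R,S$ central $C$-algebras (i.e. $c\mapsto c\cdot 1$ is an isomorphism from $C$ onto the center). The type of an $(S,R)$-progenerator $P$ (and of the corresponding equivalence) is the automorphism $\sigma$ of $C$ with $\sigma(c)p=pc$ for all $p\in P$, $c\in C$. $R$ and $S$ are Morita equivalent over $C$ if there is an $(S,R)$-progenerator of type $\mathrm{id}_C$. ''$R$ is Morita equivalent to $R^{\mathrm{op}}$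 via a Morita equivalence of type $\sigma$'' means that there is an $(R^{\mathrm{op}},R)$-progenerator of type $\sigma$, where $R^{\mathrm{op}}$ (the opposite ring) is a $C$-algebra in the obvious way. The type of an anti-automorphism of a central $C$-algebra is its restriction to the center, viewed as an automorphism of $C$. *)

(* Defs.v *)
From HB Require Import structures.
From mathcomp Require Import all_boot all_algebra.
From mathcomp Require Import boolp classical_sets cardinality.
Set Implicit Arguments.
Unset Strict Implicit.
Unset Printing Implicit Defensive.
Import GRing.Theory.
Local Open Scope classical_set_scope.
Local Open Scope ring_scope.

(* Rings are [pzRingType]s, so the zero ring is allowed. A right R-module is a
   left module over the converse ring R^c, so that p * r is written
   [(r : R^c) *: p]; R^c also serves as the opposite ring of R. *)

Definition right_ideal (R : pzRingType) (I : set R) : Prop :=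
  [/\ I 0, forall x y, I x -> I y -> I (x - y)
    & forall x r, I x -> I (x * r)].

Definition maximal_right_ideal (R : pzRingType) (I : set R) : Prop :=
  [/\ right_ideal I, I <> [set: R]
    & forall J, right_ideal J -> I `<=` J -> J = I \/ J = [set: R]].

(* If R = 0 there is no maximal right ideal, and this is all of R. *)
Definition jacobson (R : pzRingType) : set R :=
  [set x | forall I, maximal_right_ideal I -> I x].
Arguments jacobson R : clear implicits.

(* The regular right module is semisimple: every submodule is a summand. *)
Definition semisimple_ring (R : pzRingType) : Prop :=
  forall I : set R, right_ideal I ->
  exists J : set R, [/\ right_ideal J, I `&` J = [set 0]
    & forall x, exists y z, [/\ I y, J z & x = y + z]].

Definition right_artinian (R : pzRingType) : Prop :=
  forall I : nat -> set R, (forall n, right_ideal (I n)) ->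
  (forall n, I n.+1 `<=` I n) -> exists n, forall m, (n <= m)%N -> I m = I n.

(* MathComp only quotients commutative rings by ideals, so R / Jac(R) is given,
   up to isomorphism, as a surjective image of R with kernel Jac(R). *)
Definition semilocal (R : pzRingType) : Prop :=
  exists (A : pzRingType) (pi : {rmorphism R -> A}),
    [/\ forall a, exists x, pi x = a,
        forall x, pi x = 0 <-> jacobson R x,
        semisimple_ring A & right_artinian A].

Definition biadditive (M N T : zmodType) (t : M -> N -> T) : Prop :=
  (forall n, zmod_morphism (t^~ n)) /\ (forall m, zmod_morphism (t m)).

Definition is_tensorZ (M N T : zmodType) (t : M -> N -> T) : Prop :=
  biadditive t /\
  forall (W : zmodType) (b : M -> N -> W), biadditive b ->
  exists f : {additive T -> W}, (forall m n, f (t m n) = b m n) /\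
    forall g : {additive T -> W}, (forall m n, g (t m n) = b m n) -> f =1 g.

(* V is the tensor product of R and Q over Z, with its usual Q-vector space
   structure; finite dimensionality is built into [vectType]. *)
Definition Q_finite (R : pzRingType) : Prop :=
  exists (V : vectType rat) (t : R -> rat -> V),
    [/\ is_tensorZ t, forall r a b, t r (a * b) = a *: t r b
      & finite_set [set r | t r 1 = 0]].

Definition central (R : pzRingType) : {pred R} :=
  fun x => `[< forall y : R, x * y = y * x >].
Arguments central R : clear implicits.

Lemma centralP (R : pzRingType) (x : R) :
  reflect (forall y, x * y = y * x) (x \in central R).
Proof. exact: asboolP. Qed.

Lemma central_subring_closed (R : pzRingType) : subring_closed (central R).
Proof.
split.
- by apply/centralP => y; rewrite mul1r mulr1.
- move=> x y /centralP hx /centralP hy; apply/centralP => z.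
  by rewrite mulrBl mulrBr hx hy.
- move=> x y /centralP hx /centralP hy; apply/centralP => z.
  by rewrite -mulrA hy mulrA hx mulrA.
Qed.

HB.instance Definition _ (R : pzRingType) :=
  GRing.isSubringClosed.Build R (central R) (@central_subring_closed R).

Record center (R : pzRingType) : Type :=
  Center { center_val : R; center_valP : center_val \in central R }.

HB.instance Definition _ (R : pzRingType) := [isSub for @center_val R].
HB.instance Definition _ (R : pzRingType) := [Choice of center R by <:].
HB.instance Definition _ (R : pzRingType) :=
  GRing.SubChoice_isSubPzRing.Build R (central R) (center R)
    (@central_subring_closed R).

Lemma center_mulC (R : pzRingType) : commutative (@GRing.mul (center R)).
Proof.
by move=> x y; apply: val_inj; rewrite !rmorphM /=; apply/centralP/center_valP.
Qed.

HB.instance Definition _ (R : pzRingType) :=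
  GRing.PzRing_hasCommutativeMul.Build (center R) (@center_mulC R).

(* MathComp's [algType] excludes the zero ring, hence this bundle; [calg_map]
   is the structure map c |-> c * 1. *)
Record central_alg (C : comPzRingType) := CentralAlg {
  calg_sort :> pzRingType;
  calg_map : {rmorphism C -> calg_sort};
  calg_map_inj : injective calg_map;
  calg_map_center : forall a, (exists c, calg_map c = a) <-> a \in central calg_sort
}.

Lemma center_alg_map (R : pzRingType) (a : R) :
  (exists c : center R, \val c = a) <-> a \in central R.
Proof.
split=> [[c <-]|ha]; first exact: center_valP.
by exists (Center ha).
Qed.

Definition center_alg (R : pzRingType) : central_alg (center R) :=
  @CentralAlg (center R) R (\val : {rmorphism center R -> R}) val_inj
    (@center_alg_map R).

Section Opposite.
Variables (C : comPzRingType) (A : central_alg C).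

Definition op_map (c : C) : A^c := calg_map A c.

Fact op_map_zmod_morphism : zmod_morphism op_map.
Proof. exact: (raddfB (calg_map A)). Qed.

Fact op_map_monoid_morphism : monoid_morphism op_map.
Proof.
split; first exact: (rmorph1 (calg_map A)).
by move=> c d; rewrite /op_map mulrC rmorphM.
Qed.

HB.instance Definition _ :=
  GRing.isZmodMorphism.Build C A^c op_map op_map_zmod_morphism.
HB.instance Definition _ :=
  GRing.isMonoidMorphism.Build C A^c op_map op_map_monoid_morphism.

Fact op_map_center (a : A^c) :
  (exists c, op_map c = a) <-> a \in central A^c.
Proof.
rewrite /op_map (calg_map_center (a : A)).
by split=> /centralP h; apply/centralP => y; apply/esym/h.
Qed.

Definition op_alg : central_alg C :=
  @CentralAlg C A^c (op_map : {rmorphism C -> A^c}) (@calg_map_inj C A)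
    op_map_center.
End Opposite.

(* The type of an anti-automorphism is its restriction to the center, viewed
   as an automorphism of C. *)
Definition anti_automorphism (A : pzRingType) (alpha : A -> A) : Prop :=
  [/\ bijective alpha, zmod_morphism alpha, alpha 1 = 1
    & forall x y, alpha (x * y) = alpha y * alpha x].

Definition anti_automorphism_of_type (C : comPzRingType) (A : central_alg C)
    (sigma : C -> C) (alpha : A -> A) : Prop :=
  anti_automorphism alpha /\
  forall c, alpha (calg_map A c) = calg_map A (sigma c).

Section Progenerator.
Variables (A : pzRingType) (P : lmodType A).

Definition finitely_generated : Prop :=
  exists s : seq P, forall p, exists a : 'I_(size s) -> A,
    p = \sum_(i < size s) a i *: s`_i.

Definition projective : Prop :=
  forall (M N : lmodType A) (g : {linear M -> N}) (f : {linear P -> N}),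
  (forall n, exists m, g m = n) -> exists h : {linear P -> M}, g \o h =1 f.

(* Hom(P, -) is a faithful functor. *)
Definition generator : Prop :=
  forall (M N : lmodType A) (f g : {linear M -> N}),
  (forall h : {linear P -> M}, f \o h =1 g \o h) -> f =1 g.

Definition progenerator : Prop :=
  [/\ finitely_generated, projective & generator].
End Progenerator.

(* (S, R)-bimodules: right R-modules with a left action of S by R-linear maps. *)
Record bimodule (S R : pzRingType) := Bimodule {
  bimod_sort :> lmodType R^c;
  lact : S -> {linear bimod_sort -> bimod_sort};
  lactD : forall s t p, lact (s + t) p = lact s p + lact t p;
  lact1 : forall p, lact 1 p = p;
  lactM : forall s t p, lact (s * t) p = lact s (lact t p)
}.

Definition bimod_progenerator (S R : pzRingType) (P : bimodule S R) : Prop :=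
  progenerator P /\
  forall f : {linear P -> P}, exists! s : S, f =1 lact P s.

Section Morita.
Variables (C : comPzRingType).

Definition progenerator_of_type (S R : central_alg C) (P : bimodule S R)
    (sigma : C -> C) : Prop :=
  bimod_progenerator P /\
  forall c p, lact P (calg_map S (sigma c)) p = (calg_map R c : R^c) *: p.

Definition morita_of_type (sigma : C -> C) (S R : central_alg C) : Prop :=
  exists P : bimodule S R, progenerator_of_type P sigma.

Definition morita_over (R S : central_alg C) : Prop :=
  morita_of_type id S R.
End Morita.

(* Main.v *)
Require Import Defs.
From HB Require Import structures.
From mathcomp Require Import all_boot all_order all_fingroup all_algebra.
From mathcomp Require Import lra ring.
From mathcomp Require Import boolp classical_sets cardinality.
Set Implicit Arguments.
Unset Strict Implicit.
Unset Printing Implicit Defensive.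
Import GRing.Theory.
Local Open Scope ring_scope.

(* Let P be an (R^op, R)-progenerator of type sigma and let D = Hom_R(-, P), a
   duality of the category of R-progenerators. If M is a progenerator with
   h : M ~ D M, then s |-> h^-1 o D(s) o h is an anti-automorphism of type sigma
   of End(M), which is Morita equivalent to R over the center. Such an M is
   X + D X + ... + D^(k-1) X as soon as D^k X ~ X, and such an X = D^(2i) R exists
   if two of the modules D^(2i) R are isomorphic. These are progenerators with
   endomorphism ring R, and they fall into finitely many isomorphism classes:
   - the submodules of such a module P_R correspond to the right ideals of R, so
     its top has the same number of simple summands as R/Jac(R); in the semilocal
     case this leaves finitely many tops, and the top determines P;
   - in the Q-finite case, the top of P (x) Q and the top of P/nP, for n an
     exponent of the torsion of R, leave finitely many possibilities, and
     the Jordan-Zassenhaus theorem bounds the position of the image of P in the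
     top of P (x) Q; these data determine P modulo the intersection of the two
     radicals, which is nil.
   Conversely, if Q is an (S, R)-progenerator and alpha an anti-automorphism of S,
   then Q is also an (R^op, S)-bimodule through alpha, and Q (x)_S Q is an
   (R^op, R)-progenerator. *)

(** * Linear maps, quotients and dual bases *)

(** Only even powers of D are compared because D is contravariant and turns End(X) into its
    opposite; D^2 keeps the endomorphism ring R, which is what ties submodules to right ideals of R.
    A repetition D^(2i) R ~ D^(2j) R does not by itself make any single module self-dual; summing
    over an orbit does, at the price of replacing R by a Morita equivalent ring.

    The obstacle in the Q-finite case is that R need be neither semilocal nor finitely generated
    over Z (take Z, or Z[1/p]), so neither the ordinary top nor the usual lattice theorem is
    available. The two partial tops are never formed as quotients or tensor products: they are
    encoded by submodules that are saturated or contain nP, with integer multipliers in place of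
    denominators. A match of the images in both tops lifts by projectivity, and the lift is
    bijective because endomorphisms into all the chosen submodules are quasi-regular. The image of P
    need not fill the product of its simple quotients, so it is recorded by coordinates modulo a
    fixed integer k > 0; these are finite in number since R/kR is finite. *)

Section LinearMaps.
Variables (A : pzRingType) (M N : lmodType A).

Definition mklin (f : M -> N) (H : linear f) : {linear M -> N} :=
  HB.pack f (GRing.isLinear.Build A M N *:%R f H).

Lemma linear_ext (f g : {linear M -> N}) : f =1 g -> f = g.
Proof.
case: f g => [f [[fa] [fb]]] [g [[ga] [gb]]] /= /funext E; rewrite E in fa fb *.
by rewrite (Prop_irrelevance fa ga) (Prop_irrelevance fb gb).
Qed.

Fact outer_linear (h : {linear M -> A^o}) (x : N) : linear (fun p => (h p : A) *: x).
Proof. by move=> a p q; rewrite linearP scalerDl scalerA. Qed.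

Definition outer h x : {linear M -> N} := mklin (outer_linear h x).

Definition isomorphic : Prop := exists f : {linear M -> N}, bijective f.
End LinearMaps.

Section MulFunctional.
Variables (A : pzRingType) (M : lmodType A).

Fact mul_functional_linear (h : {linear M -> A^o}) (a : A) :
  linear (fun p => (h p : A) * a : A^o).
Proof.
by move=> b p q; rewrite linearP mulrDl; congr (_ + _); rewrite -[LHS]mulrA.
Qed.

Definition mul_functional h a : {linear M -> A^o} := mklin (mul_functional_linear h a).
End MulFunctional.

Section QuotientModule.
Variables (A : pzRingType) (M : lmodType A) (T : set M).
Hypotheses (T0 : T 0) (TB : forall x y, T x -> T y -> T (x - y)).
Hypothesis (TZ : forall a x, T x -> T (a *: x)).

Let TN x : T x -> T (- x). Proof. by move/(TB T0); rewrite sub0r. Qed.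
Let TD x y : T x -> T y -> T (x + y).
Proof. by move=> /TB h /TN /h; rewrite opprK. Qed.

(** The quotient is carried by the subtype of chosen representatives. The choice depends only on the
    coset as a set, so congruent elements get equal representatives. *)
Definition coset_repr (x : M) : M := xget 0 [set y | T (x - y)].

Lemma coset_reprP x : T (x - coset_repr x).
Proof.
by apply: (xgetPex 0 (P := [set y | T (x - y)]%classic)); exists x; rewrite /= subrr.
Qed.

Lemma coset_repr_eq x y : T (x - y) -> coset_repr x = coset_repr y.
Proof.
move=> Txy; have E : [set z | T (x - z)]%classic = [set z | T (y - z)]%classic.
  apply/seteqP; split=> z /= Tz.
    by have := TD (TN Txy) Tz; rewrite opprB addrA subrK.
  by have := TD Txy Tz; rewrite addrA subrK.
by rewrite /coset_repr E.
Qed.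

Definition quot : Type := {x : M | `[< coset_repr x = x >]}.
HB.instance Definition _ := Choice.on quot.

Definition quot_pi (x : M) : quot.
Proof.
exists (coset_repr x); apply/asboolP/coset_repr_eq.
by rewrite -opprB; apply/TN/coset_reprP.
Defined.

Lemma quot_piP x y : T (x - y) -> quot_pi x = quot_pi y.
Proof. by move=> h; apply: val_inj; apply: coset_repr_eq. Qed.

Lemma quot_pi_eq0 x y : quot_pi x = quot_pi y -> T (x - y).
Proof.
move=> /(congr1 val) /= h; have := TD (coset_reprP x) (TN (coset_reprP y)).
by rewrite h opprB addrA subrK.
Qed.

Lemma quot_piK (u : quot) : quot_pi (val u) = u.
Proof. by apply: val_inj; apply/asboolP; apply: (valP u). Qed.

Definition quot_add (u v : quot) := quot_pi (val u + val v).
Definition quot_opp (u : quot) := quot_pi (- val u).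
Definition quot_scale a (u : quot) := quot_pi (a *: val u).

Let TpiB x : T (coset_repr x - x).
Proof. by rewrite -opprB; apply/TN/coset_reprP. Qed.

Let piD x y : quot_add (quot_pi x) (quot_pi y) = quot_pi (x + y).
Proof. by apply: quot_piP; rewrite opprD addrACA; apply: TD; apply: TpiB. Qed.
Let piN x : quot_opp (quot_pi x) = quot_pi (- x).
Proof. by apply: quot_piP; rewrite -opprD; apply: TN; apply: TpiB. Qed.
Let piZ a x : quot_scale a (quot_pi x) = quot_pi (a *: x).
Proof. by apply: quot_piP; rewrite -scalerBr; apply: TZ; apply: TpiB. Qed.

Fact quot_addA : associative quot_add.
Proof.
by move=> u v w; rewrite -(quot_piK u) -(quot_piK v) -(quot_piK w) !piD addrA.
Qed.
Fact quot_addC : commutative quot_add.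
Proof. by move=> u v; rewrite -(quot_piK u) -(quot_piK v) !piD addrC. Qed.
Fact quot_add0 : left_id (quot_pi 0) quot_add.
Proof. by move=> u; rewrite -(quot_piK u) !piD add0r. Qed.
Fact quot_addN : left_inverse (quot_pi 0) quot_opp quot_add.
Proof. by move=> u; rewrite -(quot_piK u) piN piD addNr. Qed.

HB.instance Definition _ :=
  GRing.isZmodule.Build quot quot_addA quot_addC quot_add0 quot_addN.

Fact quot_scaleA a b (u : quot) :
  quot_scale a (quot_scale b u) = quot_scale (a * b) u.
Proof. by rewrite -(quot_piK u) !piZ scalerA. Qed.
Fact quot_scale1 : left_id 1 quot_scale.
Proof. by move=> u; rewrite -(quot_piK u) piZ scale1r. Qed.
Fact quot_scaleDr : right_distributive quot_scale +%R.
Proof.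
move=> a u v; rewrite -(quot_piK u) -(quot_piK v); move: (val u) (val v) => x y.
apply: etrans (congr1 (quot_scale a) (piD x y)) _.
rewrite (piZ a x) (piZ a y) (piZ a (x + y)) scalerDr.
exact/esym/piD.
Qed.
Fact quot_scaleDl (u : quot) : {morph quot_scale^~ u : a b / a + b}.
Proof.
move=> a b; rewrite -(quot_piK u); move: (val u) => x.
rewrite (piZ a x) (piZ b x) (piZ (a + b) x) scalerDl.
exact/esym/piD.
Qed.

HB.instance Definition _ := GRing.Zmodule_isLmodule.Build A quot
  quot_scaleA quot_scale1 quot_scaleDr quot_scaleDl.

Lemma quotient_module :
  exists (N : lmodType A) (g : {linear M -> N}), forall x, g x = 0 <-> T x.
Proof.
have pilin : linear (quot_pi : M -> quot).
  by move=> a x y; rewrite -piD -piZ.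
exists quot, (mklin pilin) => x /=; split=> [h|Tx].
  by have := quot_pi_eq0 (h : quot_pi x = quot_pi 0); rewrite subr0.
by rewrite -[0]/(quot_pi 0); apply: quot_piP; rewrite subr0.
Qed.
End QuotientModule.

Definition dual_basis (A : pzRingType) (M : lmodType A) : Prop :=
  exists n (x : 'I_n -> M) (xi : 'I_n -> {linear M -> A^o}),
    forall p, p = \sum_i (xi i p : A) *: x i.

Definition unit_trace (A : pzRingType) (M : lmodType A) : Prop :=
  exists n (y : 'I_n -> M) (eta : 'I_n -> {linear M -> A^o}),
    \sum_i eta i (y i) = 1 :> A.

Section Progenerators.
Variables (A : pzRingType) (M : lmodType A).

Lemma dual_basis_fin (I : finType) (x : I -> M) (xi : I -> {linear M -> A^o}) :
  (forall p, p = \sum_i (xi i p : A) *: x i) -> dual_basis M.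
Proof.
move=> xE; exists #|I|, (x \o enum_val), (xi \o enum_val) => p.
rewrite {1}(xE p) (reindex (fun i : 'I_#|I| => enum_val i)) //.
exact: (onW_bij _ (enum_val_bij _)).
Qed.

Lemma unit_trace_fin (I : finType) (y : I -> M) (eta : I -> {linear M -> A^o}) :
  \sum_i eta i (y i) = 1 :> A -> unit_trace M.
Proof.
move=> E; exists #|I|, (y \o enum_val), (eta \o enum_val).
rewrite -[RHS]E [RHS](reindex (fun i : 'I_#|I| => enum_val i)) //.
exact: (onW_bij _ (enum_val_bij _)).
Qed.

(** The dual basis lemma; the functionals come from lifting the identity along a surjection from a
    free module. *)
Lemma dual_basisP : dual_basis M <-> finitely_generated M /\ projective M.
Proof.
split=> [[n [x [xi xE]]]|[[s sE] pM]].
  split.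
    exists (mkseq (fun i => odflt 0 (omap x (insub i))) n) => p.
    have sz : size (mkseq (fun i => odflt 0 (omap x (insub i))) n) = n.
      by rewrite size_mkseq.
    exists (fun i => xi (cast_ord sz i) p).
    rewrite {1}(xE p) (reindex (cast_ord sz)) /=; last first.
      by exists (cast_ord (esym sz)) => i _; rewrite ?cast_ordK ?cast_ordKV.
    apply: eq_bigr => i _; congr (_ *: _).
    by rewrite nth_mkseq -?[X in (_ < X)%N]sz // (insubT (fun i => i < n)%N)
      -?[X in (_ < X)%N]sz // => h /=; congr x; apply: val_inj.
  move=> M' N g f gs; have [z zE] := choice (fun i => gs (f (x i))).
  have hlin : linear (fun p => \sum_i (xi i p : A) *: z i).
    move=> a p q; rewrite scaler_sumr -big_split /=; apply: eq_bigr => i _.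
    by rewrite linearP scalerDl scalerA.
  exists (mklin hlin) => p /=; rewrite linear_sum {2}(xE p) linear_sum.
  by apply: eq_bigr => i _; rewrite !linearZ /= zE.
have glin : linear (fun v : 'rV[A]_(size s) => \sum_i v 0 i *: s`_i).
  move=> a u v; rewrite scaler_sumr -big_split /=; apply: eq_bigr => i _.
  by rewrite !mxE scalerDl scalerA.
have [//|h hE] := pM _ M (mklin glin) (mklin (fun a (x y : M) => erefl (a *: x + y))).
  move=> p; have [a ->] := sE p; exists (\row_i a i) => /=.
  by apply: eq_bigr => i _; rewrite mxE.
have xilin i : linear (fun p => h p 0 i : A^o).
  by move=> a p q; rewrite linearP !mxE.
exists (size s), (fun i => s`_i), (fun i => mklin (xilin i)) => p.
by have := hE p => /= {1}<-.
Qed.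

Lemma trace_faithful (a : A) : unit_trace M -> (forall x : M, a *: x = 0) -> a = 0.
Proof.
move=> [n [y [eta E]]] h; rewrite -[a]mulr1 -E mulr_sumr big1 // => i _.
have : eta i (a *: y i) = a * eta i (y i) by rewrite linearZ.
by rewrite h linear0.
Qed.

Lemma unit_traceP : unit_trace M <-> generator M.
Proof.
split=> [[n [y [eta etaE]]] M' N f g fg m|gM].
  have -> : m = \sum_i outer (eta i) m (y i).
    by rewrite -scaler_suml etaE scale1r.
  by rewrite !linear_sum; apply: eq_bigr => i _; apply: fg.
(* The trace ideal of [M]. The projection onto its quotient and the zero map agree on every image of
   [M], so for a generator they coincide and 1 lies in [T]. *)
pose T : set A^o := [set a | exists n (y : 'I_n -> M)
  (eta : 'I_n -> {linear M -> A^o}), \sum_i eta i (y i) = a]%classic.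
have T0 : T 0.
  by exists 0, (fun=> 0), (fun=> mklin (fun _ _ _ => etrans (esym (addr0 _))
    (congr1 (+%R^~ _) (esym (scaler0 _ _))))); rewrite big_ord0.
have TB x y : T x -> T y -> T (x - y).
  move=> [n [u [f <-]]] [m [v [g <-]]].
  exists (n + m)%N,
    (fun i => match split i with inl i => u i | inr j => - v j end),
    (fun i => match split i with inl i => f i | inr j => g j end).
  rewrite big_split_ord /= -sumrN; congr (_ + _); apply: eq_bigr => i _.
    by case: splitP => j /= E; [congr (f _ (u _)); apply: val_inj|
      have := ltn_ord i; rewrite E ltnNge leq_addr].
  case: splitP => j /= E; first by have := ltn_ord j; rewrite -E ltnNge leq_addr.
  by rewrite -linearN; congr (g _ (- v _)); apply: val_inj; move/addnI: E.
have TZ a x : T x -> T (a *: x).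
  move=> [n [u [f <-]]]; exists n, (fun i => a *: u i), f.
  by rewrite scaler_sumr; apply: eq_bigr => i _; rewrite linearZ.
have [N [g gE]] := quotient_module T0 TB TZ.
have zlin : linear (fun _ : A^o => 0 : N).
  by move=> a x y; rewrite scaler0 addr0.
have : g =1 mklin zlin.
  apply: gM => h p /=; apply/gE; exists 1, (fun=> p), (fun=> h).
  by rewrite big_ord1.
by move=> /(_ 1) /= /gE [n [y [eta E]]]; exists n, y, eta.
Qed.

Lemma progeneratorP : progenerator M <-> dual_basis M /\ unit_trace M.
Proof.
split=> [[fM pM gM]|[/dual_basisP[fM pM] /unit_traceP gM]]; last by split.
by split; [apply/dual_basisP|apply/unit_traceP].
Qed.
End Progenerators.

(** * The duality Hom(-, P) *)

Section LinearMapZmodule.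
Variables (A : pzRingType) (M N : lmodType A).

Definition linmap : Type := {linear M -> N}.
Identity Coercion linmap_linear : linmap >-> GRing.Linear.type.

HB.instance Definition _ := gen_eqMixin linmap.
HB.instance Definition _ := gen_choiceMixin linmap.

Let add (f g : linmap) : linmap := f \+ g.
Let opp (f : linmap) : linmap := \- f.

Fact linmap_addA : associative add.
Proof. by move=> f g h; apply: linear_ext => x /=; rewrite addrA. Qed.
Fact linmap_addC : commutative add.
Proof. by move=> f g; apply: linear_ext => x /=; rewrite addrC. Qed.
Fact linmap_add0 : left_id (\0 : linmap) add.
Proof. by move=> f; apply: linear_ext => x /=; rewrite add0r. Qed.
Fact linmap_addN : left_inverse (\0 : linmap) opp add.
Proof. by move=> f; apply: linear_ext => x /=; rewrite addNr. Qed.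

HB.instance Definition _ :=
  GRing.isZmodule.Build linmap linmap_addA linmap_addC linmap_add0 linmap_addN.

Lemma linmap_sum (I : finType) (f : I -> linmap) x :
  (\sum_i f i) x = \sum_i f i x.
Proof. by apply: (big_morph (fun h : linmap => h x)). Qed.
End LinearMapZmodule.

Section DualModule.
Variables (S R : pzRingType) (P : bimodule S R) (M : lmodType R^c).

(* Hom_R(M, P), a left S-module through the action of S on P. *)
Definition dual : Type := linmap M P.
Identity Coercion dual_linmap : dual >-> linmap.
HB.instance Definition _ := GRing.Zmodule.on dual.

Let scale s (f : dual) : dual := lact P s \o (f : {linear M -> P}).

Fact dual_scaleA s t f : scale s (scale t f) = scale (s * t) f.
Proof. by apply: linear_ext => x /=; rewrite lactM. Qed.
Fact dual_scale1 : left_id 1 scale.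
Proof. by move=> f; apply: linear_ext => x /=; rewrite lact1. Qed.
Fact dual_scaleDr : right_distributive scale +%R.
Proof. by move=> s f g; apply: linear_ext => x /=; rewrite linearD. Qed.
Fact dual_scaleDl f : {morph scale^~ f : s t / s + t}.
Proof. by move=> s t; apply: linear_ext => x /=; rewrite lactD. Qed.

HB.instance Definition _ := GRing.Zmodule_isLmodule.Build S dual
  dual_scaleA dual_scale1 dual_scaleDr dual_scaleDl.
End DualModule.

Section Duality.
Variables (S R : pzRingType) (P : bimodule S R).
Hypothesis HP : bimod_progenerator P.
Local Notation A := R^c.

Let P_dual : dual_basis P.
Proof. by case: HP => /progeneratorP[]. Qed.
Let P_trace : unit_trace P.
Proof. by case: HP => /progeneratorP[]. Qed.

Lemma lact_inj s t : (forall p, lact P s p = lact P t p) -> s = t.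
Proof.
move=> E; have [u [_ uu]] := HP.2 (lact P s).
by rewrite -(uu s (fun=> erefl)) -(uu t E).
Qed.

Lemma lact0 p : lact P 0 p = 0.
Proof. by apply: (addrI (lact P 0 p)); rewrite -lactD !addr0. Qed.

Lemma lact_sum (I : finType) (s : I -> S) p :
  lact P (\sum_i s i) p = \sum_i lact P (s i) p.
Proof.
by apply: (big_morph (fun s => lact P s p)) => [s' t|]; rewrite ?lactD ?lact0.
Qed.

(** The Morita pairing of P with Hom_R(P, R) into [S], available because [S] is the whole
    endomorphism ring. *)
Definition rank1 (p : P) (h : {linear P -> A^o}) : S :=
  projT1 (cid (HP.2 (outer h p))).

Lemma rank1E p h q : lact P (rank1 p h) q = (h q : A) *: p.
Proof. by rewrite /rank1; case: cid => s /= [<-]. Qed.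

Lemma rank1D p q h : rank1 (p + q) h = rank1 p h + rank1 q h.
Proof. by apply: lact_inj => r; rewrite lactD !rank1E scalerDr. Qed.

Lemma rank1_lact s p h : rank1 (lact P s p) h = s * rank1 p h.
Proof. by apply: lact_inj => r; rewrite lactM !rank1E linearZ. Qed.

Lemma rank1_sum (I : finType) (p : I -> P) h :
  rank1 (\sum_i p i) h = \sum_i rank1 (p i) h.
Proof.
apply: (big_morph (rank1^~ h)) => [p1 p2|]; first exact: rank1D.
by apply: lact_inj => r; rewrite rank1E lact0 scaler0.
Qed.

Lemma rank1_dual n (x : 'I_n -> P) (xi : 'I_n -> {linear P -> A^o}) :
  (forall p, p = \sum_i (xi i p : A) *: x i) -> \sum_i rank1 (x i) (xi i) = 1.
Proof.
move=> xE; apply: lact_inj => p; rewrite lact1 lact_sum {2}(xE p).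
by apply: eq_bigr => i _; rewrite rank1E.
Qed.

Lemma rank1_trace n (y : 'I_n -> P) (eta : 'I_n -> {linear P -> A^o}) p :
  \sum_i eta i (y i) = 1 :> A -> p = \sum_i lact P (rank1 p (eta i)) (y i).
Proof.
move=> E; rewrite -[LHS]scale1r -E scaler_suml.
by apply: eq_bigr => i _; rewrite rank1E.
Qed.

Lemma bimod_faithful (a : A) : (forall p : P, a *: p = 0) -> a = 0.
Proof.
exact: trace_faithful P_trace.
Qed.

(** By [rank1_trace] each [p] is a sum of [rank1 p (eta i)] applied to [y i], so [G] is determined
    by the values [G (y i)]. *)
Lemma double_centralizer (G : P -> P) : {morph G : p q / p + q} ->
  (forall s p, G (lact P s p) = lact P s (G p)) ->
  exists a : A, forall p, G p = a *: p.
Proof.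
have [n [y [eta E]]] := P_trace => GD Gl.
have G0 : G 0 = 0 by apply: (addrI (G 0)); rewrite -GD !addr0.
exists (\sum_i eta i (G (y i))) => p.
rewrite {1}(rank1_trace p E) (big_morph G GD G0) scaler_suml.
by apply: eq_bigr => i _; rewrite Gl rank1E.
Qed.

Definition dual_map (M N : lmodType A) (f : {linear M -> N}) (h : dual P N) :
  dual P M := (h : {linear N -> P}) \o f.

Fact dual_map_linear (M N : lmodType A) (f : {linear M -> N}) :
  linear (dual_map f).
Proof. by move=> s g h; apply: linear_ext. Qed.

Definition dual_linear (M N : lmodType A) (f : {linear M -> N}) :
  {linear dual P N -> dual P M} := mklin (dual_map_linear f).

Lemma dual_prod (M N : lmodType A) :
  isomorphic (dual P (M * N)%type) (dual P M * dual P N)%type.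
Proof.
have l1 : linear (fun x : M => (x, 0 : N)).
  by move=> a x y; apply: injective_projections; rewrite //= scaler0 addr0.
have l2 : linear (fun x : N => (0 : M, x)).
  by move=> a x y; apply: injective_projections; rewrite //= scaler0 addr0.
pose F h := (dual_linear (mklin l1) h, dual_linear (mklin l2) h).
have Flin : linear F.
  by move=> s g h; rewrite /F !linearP.
have glin (u : dual P M * dual P N) : linear (fun x : M * N => u.1 x.1 + u.2 x.2).
  by move=> a x y; rewrite /= !linearP scalerDr addrACA.
exists (mklin Flin); exists (fun u => mklin (glin u)) => [h|[u v]].
  apply: linear_ext => -[x y] /=; rewrite -linearD; congr (h _).
  by apply: injective_projections; rewrite /= ?addr0 ?add0r.
by congr (_, _); apply: linear_ext => x /=; rewrite linear0 ?addr0 ?add0r.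
Qed.

Definition dual_elem (M : lmodType A) (h : {linear M -> A^o}) (p : P) :
  dual P M := outer h p.

Lemma dual_elemD (M : lmodType A) (h : {linear M -> A^o}) p q :
  dual_elem h (p + q) = dual_elem h p + dual_elem h q.
Proof. by apply: linear_ext => m /=; rewrite scalerDr. Qed.

Lemma dual_elem_lact (M : lmodType A) (h : {linear M -> A^o}) s p :
  dual_elem h (lact P s p) = s *: dual_elem h p.
Proof. by apply: linear_ext => m /=; rewrite linearZ. Qed.

Fact dual_functional_linear (M : lmodType A) (m : M) (h : {linear P -> A^o}) :
  linear (fun f : dual P M => rank1 (f m) h : S^o).
Proof. by move=> s f g; rewrite /= rank1D rank1_lact. Qed.

Definition dual_functional (M : lmodType A) (m : M) (h : {linear P -> A^o}) :
  {linear dual P M -> S^o} := mklin (dual_functional_linear m h).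

(** A dual basis of [M] combines with a trace of [P]; in [dual_unit_trace] the roles are exchanged,
    a trace of [M] combining with a dual basis of [P]. *)
Lemma dual_dual_basis (M : lmodType A) : dual_basis M -> dual_basis (dual P M).
Proof.
have [n [y [eta etaE]]] := P_trace; move=> [k [x [xi xE]]].
apply: (@dual_basis_fin S (dual P M) ('I_k * 'I_n)%type
  (fun i => dual_elem (xi i.1) (y i.2))
  (fun i => dual_functional (x i.1) (eta i.2))) => f.
apply: linear_ext => m; rewrite linmap_sum.
rewrite -(pair_bigA _ (fun i j => ((dual_functional (x i) (eta j) f : S) *:
    dual_elem (xi i) (y j)) m)) /=.
rewrite {1}(xE m) linear_sum; apply: eq_bigr => i _.
rewrite linearZ /= {1}(rank1_trace (f (x i)) etaE) scaler_sumr.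
by apply: eq_bigr => j _; rewrite /= linearZ.
Qed.

Lemma dual_unit_trace (M : lmodType A) : unit_trace M -> unit_trace (dual P M).
Proof.
have [n [x [xi xE]]] := P_dual; move=> [k [u [ups upsE]]].
apply: (@unit_trace_fin S (dual P M) ('I_k * 'I_n)%type
  (fun i => dual_elem (ups i.1) (x i.2))
  (fun i => dual_functional (u i.1) (xi i.2))).
rewrite -(pair_bigA _ (fun i j => rank1 ((ups i (u i) : A) *: x j) (xi j))) /=.
rewrite exchange_big /= -[RHS](rank1_dual xE); apply: eq_bigr => j _.
by rewrite -rank1_sum -scaler_suml upsE scale1r.
Qed.

(** For fixed [i] and [m], the value at [m] of [G (dual_elem (xi i) p)] commutes with [S] as a
    function of [p], hence is a scaling by some [a (i, m)]; these scalars are the coordinates of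
    [g m]. *)
Lemma dual_full (M : lmodType A) (G : {linear dual P M -> dual P M}) :
  dual_basis M -> exists g : {linear M -> M}, forall h, G h = dual_map g h.
Proof.
move=> [k [x [xi xE]]].
have /choice[a aE] (im : 'I_k * M) :
    exists a : A, forall p, G (dual_elem (xi im.1) p) im.2 = a *: p.
  case: im => i m /=; apply: double_centralizer => [p q|s p].
    by rewrite dual_elemD linearD.
  by rewrite dual_elem_lact linearZ.
have glin : linear (fun m => \sum_i a (i, m) *: x i).
  move=> c m m'; rewrite scaler_sumr -big_split; apply: eq_bigr => i _ /=.
  rewrite scalerA -scalerDl; congr (_ *: _).
  apply/eqP; rewrite -subr_eq0; apply/eqP/bimod_faithful => p.
  rewrite scalerBl scalerDl -scalerA -!aE /= linearP /=.
  by rewrite subrr.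
exists (mklin glin) => h; apply: linear_ext => m /=.
have {1}-> : h = \sum_i dual_elem (xi i) (h (x i)).
  apply: linear_ext => m'; rewrite linmap_sum {1}(xE m') linear_sum.
  by apply: eq_bigr => i _; rewrite linearZ.
rewrite linear_sum linmap_sum linear_sum; apply: eq_bigr => i _.
by rewrite (aE (i, m)) linearZ.
Qed.

Lemma dual_map_inj (M : lmodType A) (f g : {linear M -> M}) : dual_basis M ->
  (forall h, dual_map f h = dual_map g h) -> f =1 g.
Proof.
move=> [k [x [xi xE]]] E m; rewrite (xE (f m)) (xE (g m)).
apply: eq_bigr => i _; congr (_ *: _); apply/eqP; rewrite -subr_eq0.
apply/eqP/bimod_faithful => p; apply/eqP; rewrite scalerBl subr_eq0; apply/eqP.
exact: (congr1 (fun h : dual P M => h m) (E (dual_elem (xi i) p))).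
Qed.
End Duality.

(** * Modules isomorphic to their dual *)

Section EndomorphismRing.
Variables (A : pzRingType) (M : lmodType A).

Definition endo : Type := linmap M M.
Identity Coercion endo_linmap : endo >-> linmap.
HB.instance Definition _ := GRing.Zmodule.on endo.

Let mul (f g : endo) : endo := (f : {linear M -> M}) \o (g : {linear M -> M}).

Fact endo_mulA : associative mul.
Proof. by move=> f g h; apply: linear_ext. Qed.
Fact endo_mul1 : left_id (idfun : {linear M -> M}) mul.
Proof. by move=> f; apply: linear_ext. Qed.
Fact endo_mulr1 : right_id (idfun : {linear M -> M}) mul.
Proof. by move=> f; apply: linear_ext. Qed.
Fact endo_mulDl : left_distributive mul +%R.
Proof. by move=> f g h; apply: linear_ext. Qed.
Fact endo_mulDr : right_distributive mul +%R.
Proof. by move=> f g h; apply: linear_ext => x /=; rewrite linearD. Qed.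

HB.instance Definition _ := GRing.Zmodule_isPzRing.Build endo
  endo_mulA endo_mul1 endo_mulr1 endo_mulDl endo_mulDr.
End EndomorphismRing.

Section SelfDual.
Variables (C : comPzRingType) (R : central_alg C).
Local Notation A := (R : pzRingType)^c.
Variables (M : lmodType A) (M_dual : dual_basis M) (M_trace : unit_trace M).

Lemma calg_map_comm c (a : A) : (calg_map R c : A) * a = a * (calg_map R c : A).
Proof.
have /(calg_map_center (calg_map R c)) /centralP h : exists d, calg_map R d = calg_map R c.
  by exists c.
exact (esym (h a)).
Qed.

Fact homothety_linear c : linear (fun x : M => (calg_map R c : A) *: x).
Proof. by move=> a x y; rewrite scalerDr !scalerA calg_map_comm. Qed.

Definition homothety c : endo M := mklin (homothety_linear c).

Fact homothety_zmod_morphism : zmod_morphism homothety.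
Proof.
by move=> c d; apply: linear_ext => x /=; rewrite (raddfB (calg_map R)) scalerBl.
Qed.

Fact homothety_monoid_morphism : monoid_morphism homothety.
Proof.
split; first by apply: linear_ext => x /=; rewrite rmorph1 scale1r.
move=> c d; apply: linear_ext => x /=; rewrite scalerA rmorphM.
by congr (_ *: x); apply: (calg_map_comm d (calg_map R c)).
Qed.

HB.instance Definition _ :=
  GRing.isZmodMorphism.Build C (endo M) homothety homothety_zmod_morphism.
HB.instance Definition _ :=
  GRing.isMonoidMorphism.Build C (endo M) homothety homothety_monoid_morphism.

Fact homothety_inj : injective homothety.
Proof.
move=> c d E; apply: (@calg_map_inj C R); apply/eqP; rewrite -subr_eq0; apply/eqP.
apply: (trace_faithful M_trace) => x; rewrite scalerBl; apply/eqP; rewrite subr_eq0.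
exact/eqP/(congr1 (fun f : endo M => f x) E).
Qed.

(** A central [z] commutes with each [outer (eta i) x], which makes it the scaling by [a]; linearity
    of [z] and faithfulness of [M] then make [a] central. *)
Fact homothety_center (z : endo M) : (exists c, homothety c = z) <-> z \in central (endo M).
Proof.
split=> [[c <-]|/centralP zC].
  by apply/centralP => f; apply: linear_ext => x /=; rewrite linearZ.
have [n [y [eta E]]] := M_trace.
pose a : A := \sum_i eta i (z (y i)).
have za x : z x = a *: x.
  rewrite -{1}[x]scale1r -E scaler_suml linear_sum scaler_suml.
  apply: eq_bigr => i _.
  exact: (congr1 (fun f : endo M => f (y i)) (zC (outer (eta i) x))).
have /(calg_map_center (a : R))[c cE] : (a : R) \in central R.
  apply/centralP => b; apply/eqP; rewrite -subr_eq0; apply/eqP.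
  apply: (trace_faithful (a := (b : A) * a - a * (b : A)) M_trace) => x.
  by rewrite scalerBl -!scalerA -!za linearZ subrr.
by exists c; apply: linear_ext => x /=; rewrite cE za.
Qed.

Definition endo_alg : central_alg C :=
  @CentralAlg C (endo M) (homothety : {rmorphism C -> endo M}) homothety_inj
    homothety_center.

Definition endo_bimodule : bimodule endo_alg R :=
  @Bimodule endo_alg R M (fun f : endo M => f) (fun _ _ _ => erefl) (fun=> erefl)
    (fun _ _ _ => erefl).

Lemma endo_alg_morita : morita_over R endo_alg.
Proof.
exists endo_bimodule; split=> //; split; first exact/progeneratorP.
by move=> f; exists f; split=> // g /= E; apply: linear_ext.
Qed.

(* A form [M -> M -> P] with [h] bijective has an adjoint: [h (alpha f y) x] is
   [h y (f x)]. *)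
Lemma endo_anti_automorphism (P : bimodule (op_alg R) R) sigma :
  progenerator_of_type P sigma -> isomorphic M (dual P M) ->
  exists alpha : endo_alg -> endo_alg, anti_automorphism_of_type sigma alpha.
Proof.
move=> [HP Psigma] [h [k hK kK]].
have klin : linear k by move=> a x y; apply: (can_inj hK); rewrite kK linearP !kK.
pose alpha (f : endo M) : endo M := mklin klin \o (dual_linear P f \o h).
have hE f x y : h (alpha f y) x = h y (f x) by rewrite /= kK.
have adjE (f g : endo M) : (forall x y, h (g y) x = h y (f x)) -> alpha f = g.
  move=> E; apply: linear_ext => y; apply: (can_inj hK); apply: linear_ext => x.
  by rewrite hE -E.
have alpha_inj : injective alpha.
  move=> f g E; apply: linear_ext; apply: (dual_map_inj HP M_dual) => u.
  rewrite -[u]kK; apply: linear_ext => x; rewrite /dual_map /=.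
  by rewrite -!hE E.
have alpha_surj (g : endo M) : exists f, alpha f = g.
  have [f fE] := dual_full HP (h \o ((g : {linear M -> M}) \o mklin klin)) M_dual.
  exists f; apply: adjE => x y; have := congr1 (fun u : dual P M => u x) (fE (h y)).
  by rewrite /= hK.
have [beta betaK] := choice alpha_surj.
exists alpha; split; first split.
- by exists beta => // f; apply: alpha_inj; rewrite betaK.
- move=> f g; apply: adjE => x y.
  rewrite -[(f - g) x]/((f : endo M) x - (g : endo M) x).
  rewrite -[X in h X]/(alpha f y - alpha g y) linearB.
  by rewrite -[LHS]/(h (alpha f y) x - h (alpha g y) x) !hE linearB.
- exact: adjE.
- by move=> f g; apply: adjE => x y; rewrite -[X in h X]/(alpha g (alpha f y)) !hE.
- move=> c; apply: adjE => x y /=; rewrite !linearZ /=.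
  by rewrite -Psigma.
Qed.
End SelfDual.

(** * The progenerator of an anti-automorphism *)

Section Twist.
Variables (S R : pzRingType) (Q : bimodule S R).
Hypothesis HQ : bimod_progenerator Q.
Local Notation A := R^c.
Variables (alpha beta : S -> S).
Hypotheses (alphaK : cancel alpha beta) (betaK : cancel beta alpha).
Hypotheses (betaB : zmod_morphism beta) (beta1 : beta 1 = 1).
Hypothesis betaM : forall s t, beta (s * t) = beta t * beta s.

Let betaD s t : beta (s + t) = beta s + beta t.
Proof.
by have := betaB (s + t) t; rewrite addrK => ->; rewrite subrK.
Qed.

Let beta0 : beta 0 = 0.
Proof. by have := betaB 0 0; rewrite !subrr. Qed.

Definition precomp (u : linmap Q A^o) (s : S) : linmap Q A^o :=
  (u : {linear Q -> A^o}) \o lact Q s.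

Definition rmul (u : linmap Q A^o) (a : A) : linmap Q A^o := mul_functional u a.

(* Q^beta (x)_S Q, realized as the additive maps [f : Hom_R(Q, R) -> Q] with
   f (u s) = beta(s) f(u). *)
Record twist := Twist {
  twist_fun :> linmap Q A^o -> Q;
  twistD : {morph twist_fun : u v / u + v};
  twist_precomp : forall s u, twist_fun (precomp u s) = lact Q (beta s) (twist_fun u)
}.

Lemma twist_ext (f g : twist) : f =1 g -> f = g.
Proof.
case: f g => [f fD fS] [g gD gS] /= /funext E; rewrite E in fD fS *.
by rewrite (Prop_irrelevance fD gD) (Prop_irrelevance fS gS).
Qed.

HB.instance Definition _ := gen_eqMixin twist.
HB.instance Definition _ := gen_choiceMixin twist.

Definition twist_zero : twist.
Proof.
refine (@Twist (fun=> 0) _ _).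
- by move=> u v; rewrite addr0.
- by move=> u v; rewrite linear0.
Defined.

Definition twist_add (f g : twist) : twist.
Proof.
refine (@Twist (fun u => f u + g u) _ _).
- by move=> u v; rewrite !twistD addrACA.
- by move=> u v; rewrite !twist_precomp linearD.
Defined.

Definition twist_opp (f : twist) : twist.
Proof.
refine (@Twist (fun u => - f u) _ _).
- by move=> u v; rewrite twistD opprD.
- by move=> u v; rewrite twist_precomp linearN.
Defined.

Definition twist_scale (a : A) (f : twist) : twist.
Proof.
refine (@Twist (fun u => a *: f u) _ _).
- by move=> u v; rewrite twistD scalerDr.
- by move=> u v; rewrite twist_precomp linearZ.
Defined.

Fact twist_addA : associative twist_add.
Proof. by move=> f g h; apply: twist_ext => x /=; rewrite addrA. Qed.
Fact twist_addC : commutative twist_add.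
Proof. by move=> f g; apply: twist_ext => x /=; rewrite addrC. Qed.
Fact twist_add0 : left_id twist_zero twist_add.
Proof. by move=> f; apply: twist_ext => x /=; rewrite add0r. Qed.
Fact twist_addN : left_inverse twist_zero twist_opp twist_add.
Proof. by move=> f; apply: twist_ext => x /=; rewrite addNr. Qed.

HB.instance Definition _ :=
  GRing.isZmodule.Build twist twist_addA twist_addC twist_add0 twist_addN.

Fact twist_scaleA a b f : twist_scale a (twist_scale b f) = twist_scale (a * b) f.
Proof. by apply: twist_ext => x /=; rewrite scalerA. Qed.
Fact twist_scale1 : left_id 1 twist_scale.
Proof. by move=> f; apply: twist_ext => x /=; rewrite scale1r. Qed.
Fact twist_scaleDr : right_distributive twist_scale +%R.
Proof. by move=> s f g; apply: twist_ext => x /=; rewrite scalerDr. Qed.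
Fact twist_scaleDl f : {morph twist_scale^~ f : s t / s + t}.
Proof. by move=> s t; apply: twist_ext => x /=; rewrite scalerDl. Qed.

HB.instance Definition _ := GRing.Zmodule_isLmodule.Build A twist
  twist_scaleA twist_scale1 twist_scaleDr twist_scaleDl.

Lemma twist_sum (I : finType) (f : I -> twist) u : (\sum_i f i) u = \sum_i f i u.
Proof. by apply: (big_morph (fun h : twist => h u)). Qed.

Lemma twist_fun_sum (I : finType) (f : twist) (u : I -> linmap Q A^o) :
  f (\sum_i u i) = \sum_i f (u i).
Proof.
apply: (big_morph (twist_fun f) (twistD f)).
by apply: (addrI (f 0)); rewrite -twistD !addr0.
Qed.

Lemma rank1_precomp q (u : linmap Q A^o) s :
  rank1 HQ q (precomp u s) = rank1 HQ q u * s.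
Proof. by apply: (lact_inj HQ) => p; rewrite lactM !rank1E. Qed.

Lemma rank1_linmapD q (u v : linmap Q A^o) :
  rank1 HQ q (u + v : linmap Q A^o) = rank1 HQ q u + rank1 HQ q v.
Proof. by apply: (lact_inj HQ) => p; rewrite lactD !rank1E -scalerDl. Qed.

(** The pure tensor of [p] and [q]; [twist_elem_lact] is the balancing relation over [S]. *)
Definition twist_elem (p q : Q) : twist.
Proof.
refine (@Twist (fun u => lact Q (beta (rank1 HQ p u)) q) _ _).
- by move=> u v; rewrite rank1_linmapD betaD lactD.
- by move=> u v; rewrite rank1_precomp betaM lactM.
Defined.

Fact twist_elem_linear p : linear (twist_elem p).
Proof. by move=> a q r; apply: twist_ext => u /=; rewrite linearP. Qed.

Lemma twist_elem_lact s p q : twist_elem (lact Q s p) q = twist_elem p (lact Q (beta s) q).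
Proof. by apply: twist_ext => u /=; rewrite rank1_lact betaM lactM. Qed.

Fact twist_functional_linear (u : linmap Q A^o) (h : {linear Q -> A^o}) :
  linear (fun f : twist => h (f u)).
Proof. by move=> a f g; rewrite -linearP. Qed.

Definition twist_functional u h := mklin (twist_functional_linear u h).

Lemma linmap_trace n (y : 'I_n -> Q) (eta : 'I_n -> {linear Q -> A^o})
    (u : linmap Q A^o) : \sum_i eta i (y i) = 1 :> A ->
  u = \sum_i precomp (eta i : linmap Q A^o) (rank1 HQ (y i) u).
Proof.
move=> E; apply: linear_ext => q; rewrite linmap_sum -[LHS]mulr1 -[X in _ * X]E.
rewrite mulr_sumr; apply: eq_bigr => i _ /=.
by rewrite rank1E linearZ.
Qed.

(** Every twist is a sum of pure tensors, so linear maps out of [twist] are determined by their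
    values on these. *)
Lemma twist_trace n (y : 'I_n -> Q) (eta : 'I_n -> {linear Q -> A^o}) (f : twist) :
  \sum_i eta i (y i) = 1 :> A -> f = \sum_i twist_elem (y i) (f (eta i)).
Proof.
move=> E; apply: twist_ext => u; rewrite {1}(linmap_trace u E).
rewrite twist_fun_sum twist_sum; apply: eq_bigr => i _.
by rewrite twist_precomp.
Qed.

(** A trace on the first tensor factor and a dual basis on the second give a dual basis; exchanging
    the factors gives the trace. *)
Lemma twist_progenerator : progenerator (twist : lmodType A).
Proof.
have [/progeneratorP[[k [x [xi xE]]] [n [y [eta etaE]]]] _] := HQ.
apply/progeneratorP; split.
  apply: (@dual_basis_fin A twist ('I_n * 'I_k)%type
    (fun i => twist_elem (y i.1) (x i.2))
    (fun i => twist_functional (eta i.1) (xi i.2))) => f.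
  rewrite -(pair_bigA _ (fun i j => ((xi j (f (eta i)) : A) *:
    twist_elem (y i) (x j)))) /= {1}(twist_trace f etaE).
  apply: eq_bigr => i _; rewrite {1}(xE (f (eta i))).
  rewrite -[LHS]/(mklin (twist_elem_linear (y i)) _) linear_sum.
  by apply: eq_bigr => j _; rewrite linearZ.
apply: (@unit_trace_fin A twist ('I_n * 'I_k)%type
  (fun i => twist_elem (x i.2) (y i.1))
  (fun i => twist_functional (xi i.2) (eta i.1))).
rewrite -(pair_bigA _ (fun i j => eta i (twist_elem (x j) (y i) (xi j)))) /=.
rewrite -[RHS]etaE; apply: eq_bigr => i _; rewrite -linear_sum -lact_sum; congr (eta i _).
rewrite -(big_morph beta betaD beta0).
by rewrite (rank1_dual HQ xE) beta1 lact1.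
Qed.

(** This action comes from the first tensor factor, seen through its functionals. *)
Definition twist_lact_fun (a : A) (f : twist) : twist.
Proof.
refine (@Twist (fun u => f (rmul u a)) _ _).
- by move=> u v; rewrite -twistD; congr (f _); apply: linear_ext => q /=; rewrite mulrDl.
- by move=> u v; rewrite -twist_precomp; congr (f _); apply: linear_ext.
Defined.

Fact twist_lact_linear a : linear (twist_lact_fun a).
Proof. by move=> b f g; apply: twist_ext. Qed.

Definition twist_lact a := mklin (twist_lact_linear a).

Definition twist_bimodule : bimodule A R.
Proof.
refine (@Bimodule A R twist twist_lact _ _ _).
- move=> a b f; apply: twist_ext => u.
  rewrite -[RHS]/(f (rmul u a) + f (rmul u b)) -twistD.
  by congr (f _); apply: linear_ext => q /=; rewrite mulrDr.
- move=> f; apply: twist_ext => u /=.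
  by congr (f _); apply: linear_ext => q /=; rewrite mulr1.
- move=> a b f; apply: twist_ext => u /=.
  by congr (f _); apply: linear_ext => q /=; rewrite mulrA.
Defined.

(** For an endomorphism [F], sending [q] to [F (twist_elem p q) u] is an endomorphism of [Q], hence
    an element of [S]. Its image [t p u] under [alpha] is S-linear in [p] and in [u], and such a
    pairing is [rank1] with one scalar [a] inserted between its arguments. *)
Lemma twist_bimod_progenerator : bimod_progenerator twist_bimodule.
Proof.
split=> [|F]; first exact: twist_progenerator.
have [/progeneratorP[_ [n [y [eta etaE]]]] _] := HQ.
have /choice[s sE] (pu : Q * linmap Q A^o) :
    exists s, forall q, F (twist_elem pu.1 q) pu.2 = lact Q s q.
  have l : linear (fun q => F (twist_elem pu.1 q) pu.2).
    by move=> a q r; rewrite twist_elem_linear linearP.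
  by have [s [sE _]] := HQ.2 (mklin l); exists s => q; rewrite -sE.
pose t p u := alpha (s (p, u)).
have tE p u q : F (twist_elem p q) u = lact Q (beta (t p u)) q.
  by rewrite (sE (p, u)) /t alphaK.
have beta_inj := can_inj betaK.
have t_precomp p u r : t p (precomp u r) = t p u * r.
  apply: beta_inj; apply: (lact_inj HQ) => q; rewrite betaM lactM -!tE.
  exact: (twist_precomp (F (twist_elem p q) : twist) r u).
have t_lact p u r : t (lact Q r p) u = r * t p u.
  apply: beta_inj; apply: (lact_inj HQ) => q; rewrite betaM lactM -!tE.
  by rewrite twist_elem_lact.
have tD p u v : t p (u + v) = t p u + t p v.
  apply: beta_inj; apply: (lact_inj HQ) => q; rewrite betaD lactD -!tE.
  exact: (twistD (F (twist_elem p q) : twist)).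
have tD1 p q u : t (p + q) u = t p u + t q u.
  apply: beta_inj; apply: (lact_inj HQ) => r; rewrite betaD lactD -!tE.
  have -> : twist_elem (p + q) r = twist_elem p r + twist_elem q r.
    by apply: twist_ext => v /=; rewrite rank1D betaD lactD.
  by rewrite linearD.
have t_sum p (I : finType) (u : I -> linmap Q A^o) : t p (\sum_i u i) = \sum_i t p (u i).
  apply: (big_morph (t p)) => [u1 u2|]; first exact: tD.
  by apply: (addrI (t p 0)); rewrite -tD !addr0.
have t_sum1 u (I : finType) (p : I -> Q) : t (\sum_i p i) u = \sum_i t (p i) u.
  apply: (big_morph (t^~ u)) => [p1 p2|]; first exact: tD1.
  by apply: (addrI (t 0 u)); rewrite -tD1 !addr0.
pose a : A := \sum_j \sum_k eta j (lact Q (t (y j) (eta k)) (y k)).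
have ta p u : t p u = rank1 HQ p (rmul u a).
  apply: (lact_inj HQ) => q; rewrite rank1E /= {1}(rank1_trace HQ p etaE) t_sum1.
  rewrite lact_sum mulr_sumr scaler_suml; apply: eq_bigr => j _.
  rewrite t_lact {1}(linmap_trace u etaE) t_sum mulr_sumr lact_sum.
  rewrite mulr_sumr scaler_suml; apply: eq_bigr => k _.
  by rewrite t_precomp !lactM !rank1E !linearZ.
exists a; split=> [f|b bE].
  rewrite (twist_trace f etaE) !linear_sum; apply: eq_bigr => i _.
  by apply: twist_ext => u; rewrite tE ta.
apply/eqP; rewrite -subr_eq0; apply/eqP/(bimod_faithful HQ) => q.
rewrite -[_ *: q]scale1r -etaE scaler_suml big1 // => j _.
have /(can_inj betaK) E :
    beta (rank1 HQ q (rmul (eta j) a)) = beta (rank1 HQ q (rmul (eta j) b)).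
  apply: (lact_inj HQ) => r; rewrite -ta -tE.
  exact: (congr1 (fun f : twist => f (eta j)) (bE (twist_elem q r))).
have := congr1 (fun s => lact Q s (y j)) E; rewrite /= !rank1E /= => {}E.
by rewrite scalerBl scalerBr !scalerA E subrr.
Qed.
End Twist.

Lemma anti_automorphism_morita (C : comPzRingType) (R S : central_alg C)
    (sigma : C -> C) (alpha : S -> S) :
  morita_over R S -> anti_automorphism_of_type sigma alpha ->
  morita_of_type sigma (op_alg R) R.
Proof.
move=> [Q [HQ Qid]] [[[beta alphaK betaK] alphaB alpha1 alphaM] alpha_sigma].
have alpha_inj := can_inj alphaK.
have betaB : zmod_morphism beta.
  by move=> s t; apply: alpha_inj; rewrite alphaB !betaK.
have beta1 : beta 1 = 1 by rewrite -alpha1 alphaK.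
have betaM s t : beta (s * t) = beta t * beta s.
  by apply: alpha_inj; rewrite alphaM !betaK.
exists (twist_bimodule Q beta); split.
  exact: (twist_bimod_progenerator HQ alphaK betaK betaB beta1 betaM).
move=> c f; apply: twist_ext => u.
have -> : lact (twist_bimodule Q beta) (calg_map (op_alg R) (sigma c)) f =
    twist_lact_fun (calg_map R (sigma c)) f by [].
(* As [Q] has type the identity, a central scalar moves from the R-side of the first factor to its
   S-side, and then through [beta] to the second factor, where it has become [c]. *)
have -> : twist_lact_fun (calg_map R (sigma c)) f u =
    f (precomp u (calg_map S (sigma c))).
  congr (f _); apply: linear_ext => q /=; rewrite Qid linearZ /=.
  exact/esym/calg_map_comm.
by rewrite twist_precomp -alpha_sigma alphaK Qid.
Qed.

(** * Maximal saturated submodules *)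

Section Saturated.
Variables (A : pzRingType) (b : bool) (n : nat).
Local Open Scope classical_set_scope.

(* For [b = true] submodules are required to have torsion-free quotient. *)
Definition mult (mu : nat) : bool := (0 < mu)%N && (b || (mu == 1)%N).

Lemma mult1 : mult 1.
Proof. by rewrite /mult eqxx orbT. Qed.

Lemma multM mu nu : mult mu -> mult nu -> mult (mu * nu).
Proof.
rewrite /mult muln_gt0 => /andP[-> h] /andP[-> ] /=.
by case: b h => //= /eqP-> /eqP->.
Qed.

Lemma mult_prod (I : finType) (P : pred I) (mu : I -> nat) :
  (forall i, mult (mu i)) -> mult (\prod_(i | P i) mu i)%N.
Proof. by move=> h; apply: (big_ind mult) => //; [apply: mult1|apply: multM]. Qed.

(** Parameters [true, 0] give the traces on [M] of submodules of M (x) Q, [false, n] the submodules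
    containing nM, and [false, 0] all submodules; one theory serves all three. *)
Definition good (M : lmodType A) (N : set M) : Prop :=
  [/\ N 0, forall x y, N x -> N y -> N (x - y), forall a x, N x -> N (a *: x),
      forall mu x, mult mu -> N (x *+ mu) -> N x & forall x, N (x *+ n)].

Section GoodTheory.
Variables (M : lmodType A) (N : set M).
Hypothesis NG : good N.

Lemma good0 : N 0. Proof. by case: NG. Qed.
Lemma goodB x y : N x -> N y -> N (x - y). Proof. by case: NG => _ h _ _ _; apply: h. Qed.
Lemma goodZ a x : N x -> N (a *: x). Proof. by case: NG => _ _ h _ _; apply: h. Qed.
Lemma goodS mu x : mult mu -> N (x *+ mu) -> N x.
Proof. by case: NG => _ _ _ h _; apply: h. Qed.
Lemma good_n x : N (x *+ n). Proof. by case: NG. Qed.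
Lemma goodN x : N x -> N (- x).
Proof. by move/(goodB good0); rewrite sub0r. Qed.
Lemma goodD x y : N x -> N y -> N (x + y).
Proof. by move=> hx /goodN /(goodB hx); rewrite opprK. Qed.
Lemma good_sum (I : finType) (P : pred I) (x : I -> M) :
  (forall i, P i -> N (x i)) -> N (\sum_(i | P i) x i).
Proof. by move=> h; apply: big_ind => //; [apply: good0|apply: goodD]. Qed.
Lemma goodMn x mu : N x -> N (x *+ mu).
Proof. by move=> h; rewrite -scaler_nat; apply: goodZ. Qed.
Lemma goodBr x y : N (x - y) -> N y -> N x.
Proof. by move=> h /(goodD h); rewrite subrK. Qed.
Lemma goodBl x y : N (x - y) -> N x -> N y.
Proof. by move=> /goodN h /(goodD h); rewrite opprB subrK. Qed.
End GoodTheory.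

(** Maximality in elementwise form: any [x] outside [N] generates [M] modulo [N] up to a multiplier.
    For [true, 0] it says that (M/N) (x) Q is simple. *)
Definition maxgood (M : lmodType A) (N : set M) : Prop :=
  [/\ good N, exists x, ~ N x &
      forall x y, ~ N x -> exists mu a, mult mu /\ N (y *+ mu - a *: x)].

Lemma maxgood_good (M : lmodType A) (N : set M) : maxgood N -> good N.
Proof. by case. Qed.

Definition colon (M : lmodType A) (N : set M) (p : M) : set A^o :=
  [set r : A^o | N ((r : A) *: p)].

Lemma colon_maxgood (M : lmodType A) (N : set M) p :
  maxgood N -> ~ N p -> maxgood (colon N p).
Proof.
move=> [NG _ Nmax] Np; rewrite /colon; split.
- split=> /=.
  + by rewrite scale0r; apply: good0.
  + by move=> x y; rewrite scalerBl; apply: goodB.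
  + by move=> a x; rewrite -scalerA; apply: goodZ.
  + by move=> mu x mmu; rewrite -scalerMnl; apply: goodS.
  + by move=> x; rewrite -scalerMnl; apply: good_n.
- by exists 1; rewrite /= scale1r.
- move=> x y /= hx; have [mu [a [mmu h]]] := Nmax _ ((y : A) *: p) hx.
  exists mu, a; split=> //=; by rewrite scalerBl -scalerMnl -scalerA.
Qed.

Lemma maxgood1 (m : set A^o) : maxgood m -> ~ m 1.
Proof.
move=> [mG [x mx] _] m1; apply: mx; rewrite -[x]mulr1.
exact: (goodZ mG).
Qed.

Lemma maxgood_mu (m : set A^o) mu : maxgood m -> mult mu -> ~ m mu%:R.
Proof. by move=> mm mmu /(goodS (maxgood_good mm) mmu); apply: maxgood1. Qed.

Lemma maxgood_eq (M : lmodType A) (N N' : set M) z :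
  maxgood N -> good N' -> N `<=` N' -> ~ N' z -> N' `<=` N.
Proof.
move=> [NG _ Nmax] N'G NN' N'z x N'x; apply: contrapT => Nx; apply: N'z.
have [mu [a [mmu /NN' h]]] := Nmax x z Nx.
by apply: (goodS N'G mmu); apply: (goodBr N'G h); apply: goodZ.
Qed.

Lemma good_bigcup_chain (F : set (set A^o)) :
  (forall I, F I -> good I /\ ~ I 1) -> total_on F subset -> F !=set0 ->
  good (\bigcup_(I in F) I) /\ ~ (\bigcup_(I in F) I) 1.
Proof.
move=> FG Ft [I0 FI0]; split; last by move=> [I FI I1]; case: (FG I FI).
have G I : F I -> good I by case/FG.
split.
- by exists I0 => //; exact: (good0 (G I0 FI0)).
- move=> x y [I FI Ix] [J FJ Jy].
  have [IJ|JI] := Ft I J FI FJ.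
    by exists J => //; apply: (goodB (G J FJ)) => //; apply: IJ.
  by exists I => //; apply: (goodB (G I FI)) => //; apply: JI.
- by move=> a x [I FI Ix]; exists I => //; apply: goodZ => //; apply: G.
- by move=> mu x mmu [I FI Ix]; exists I => //; apply: (goodS (G I FI) mmu).
- by move=> x; exists I0 => //; exact: (good_n (G I0 FI0)).
Qed.

Lemma good_gen (M : lmodType A) (N : set M) (x : M) : good N ->
  good [set y | exists mu a, mult mu /\ N (y *+ mu - a *: x)].
Proof.
move=> NG; split=> /=.
- exists 1%N, 0; split; first exact: mult1.
  by rewrite mul0rn scale0r subrr; apply: good0.
- move=> y z [mu [a [mmu ya]]] [nu [c [mnu zc]]].
  exists (mu * nu)%N, (a *+ nu - c *+ mu); split; first exact: multM.
  have -> : (y - z) *+ (mu * nu) - (a *+ nu - c *+ mu) *: x =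
      (y *+ mu - a *: x) *+ nu - (z *+ nu - c *: x) *+ mu.
    rewrite !mulrnBl scalerBl -!mulrnA (mulnC nu mu) !scalerMnl !opprB.
    by rewrite addrACA [RHS]addrACA [X in _ + X = _]addrC.
  by apply: (goodB NG); apply: goodMn.
- move=> d y [mu [a [mmu ya]]]; exists mu, (d * a); split=> //.
  by rewrite scalerMnr -scalerA -scalerBr; apply: goodZ.
- move=> mu y mmu [nu [a [mnu ya]]]; exists (mu * nu)%N, a.
  by rewrite mulrnA; split=> //; apply: multM.
- move=> y; exists 1%N, 0; split; first exact: mult1.
  by rewrite scale0r subr0; apply: (good_n NG).
Qed.

Lemma maxgood_above (I : set A^o) : good I -> ~ I 1 ->
  exists m, maxgood m /\ I `<=` m.
Proof.
move=> IG I1; pose Pr (J : set A^o) := [/\ good J, ~ J 1 & I `<=` J] \/ J = set0.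
have [F FP Ft|m [Pm mmax]] := @Zorn_bigcup _ Pr.
  have [[J [FJ J0]]|h] := pselect (exists J, F J /\ J <> set0); last first.
    right; apply/seteqP; split=> // x [J FJ Jx]; case: h; exists J; split=> // E.
    by rewrite E in Jx.
  left; pose F' := [set K | F K /\ K <> set0].
  have E : \bigcup_(K in F) K = \bigcup_(K in F') K.
    apply/seteqP; split=> [x [K FK Kx]|x [K [FK _] Kx]]; exists K => //.
    by split=> // K0; rewrite K0 in Kx.
  have FG K : F' K -> [/\ good K, ~ K 1 & I `<=` K] by case=> /FP [].
  rewrite E; have [|||h1 h2] := @good_bigcup_chain F'.
  - by move=> K /FG [].
  - by move=> K L [FK _] [FL _]; apply: Ft.
  - by exists J.
  have [_ _ IJ] := FG J (conj FJ J0).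
  by split=> // x /IJ Jx; exists J.
have nP0 : m <> set0.
  move=> E; case: (mmax I); last by left; split.
  by rewrite E; split=> // h; have := h 0 (good0 IG).
case: Pm => // -[mG m1 Im]; exists m; split=> //; split=> //; first by exists 1.
move=> x y mx; pose J : set A^o := [set y | exists mu a, mult mu /\ m (y *+ mu - a *: x)].
have JG : good J by apply: good_gen.
have mJ : m `<=` J.
  by move=> z mz; exists 1%N, 0; split; [exact: mult1|rewrite scale0r subr0].
have Jx : J x.
  by exists 1%N, 1; split; [exact: mult1|rewrite scale1r subrr; apply: good0].
suff J1 : J 1 by rewrite -[y]mulr1; apply: (goodZ JG).
apply: contrapT => J1; apply: (mmax J); last first.
  by left; split=> // z /Im /mJ.
by split=> // /(_ x Jx).
Qed.

(** The version with multipliers of: an element outside all maximal left ideals is left invertible.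
    Otherwise [I], which contains [u] and the multiples of [n], is proper and lies in a maximal
    one. *)
Lemma unit_modulo (u : A) : (forall m : set A^o, maxgood m -> ~ m u) ->
  exists mu a w, mult mu /\ mu%:R = a * u + w *+ n.
Proof.
move=> h; apply: contrapT => nex.
pose I : set A^o := [set y | exists mu a w, mult mu /\ y *+ mu = a * u + w *+ n].
have IG : good I.
  split.
  - by exists 1%N, 0, 0; rewrite !mul0rn mul0r addr0; split=> //; apply: mult1.
  - move=> x y [mu [a [w [mmu xE]]]] [nu [c [v [mnu yE]]]].
    exists (mu * nu)%N, (a *+ nu - c *+ mu), (w *+ nu - v *+ mu).
    split; first exact: multM.
    have {}xE : x *+ (mu * nu) = a * u *+ nu + w *+ nu *+ n.
      by rewrite mulrnA xE mulrnDl [w *+ n *+ nu]mulrnAC.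
    have {}yE : y *+ (mu * nu) = c * u *+ mu + v *+ mu *+ n.
      by rewrite mulnC mulrnA yE mulrnDl [v *+ n *+ mu]mulrnAC.
    by rewrite mulrBl !mulrnAl [in RHS]mulrnBl mulrnBl xE yE opprD addrACA.
  - move=> d x [mu [a [w [mmu xE]]]]; exists mu, (d * a), (d * w).
    split=> //; rewrite -[d *: x]/(d * x) -mulrnAr xE mulrDr mulrA.
    by rewrite mulrnAr.
  - move=> mu x mmu [nu [a [w [mnu E]]]]; exists (mu * nu)%N, a, w.
    by rewrite mulrnA; split=> //; apply: multM.
  - by move=> x; exists 1%N, 0, x; rewrite mul0r add0r; split=> //; apply: mult1.
have [|m [mm Im]] := maxgood_above IG.
  by move=> [mu [a [w [mmu E]]]]; apply: nex; exists mu, a, w.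
apply: (h m mm); apply: Im; exists 1%N, 1, 0.
by rewrite mul0rn addr0 mul1r; split=> //; apply: mult1.
Qed.

Definition good_rad (x : A) : Prop := forall m : set A^o, maxgood m -> m x.

Lemma rad_mull a x : good_rad x -> good_rad (a * x).
Proof. by move=> h m mm; apply: (goodZ (maxgood_good mm)); apply: h. Qed.

Lemma rad_colon (M : lmodType A) (N : set M) p r : maxgood N -> good_rad r -> N (r *: p).
Proof.
move=> NM hr; have [Np|Np] := pselect (N p); first by apply: goodZ => //; case: NM.
exact: hr (colon_maxgood NM Np).
Qed.

(* The a i witness the Chinese remainder theorem modulo the m i. *)
Record crt_family (l : nat) (m : 'I_l -> set A^o) (a : 'I_l -> A) (mu : nat) : Prop :=
  CrtFamily {
    crt_mu : mult mu;
    crt_max : forall i, maxgood (m i);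
    crt_rad : forall x, (forall i, m i x) -> good_rad x;
    crt_neq : forall i j, i != j -> m j (a i);
    crt_eq : forall i, m i (a i - mu%:R) }.

(** The hypothesis is a weak chain condition: it stops the greedy choice of maximal ideals, each
    failing to contain the intersection of its predecessors. A shortest family with intersection in
    the radical is irredundant, and this yields the [a i]. *)
Lemma crt_family_exists :
  (forall m : nat -> set A^o, (forall k, maxgood (m k)) ->
     exists k, forall x, (forall j, (j < k)%N -> m j x) -> m k x) ->
  exists l m a mu, @crt_family l m a mu.
Proof.
move=> nochain.
pose spans l := exists m : 'I_l -> set A^o,
  (forall i, maxgood (m i)) /\ forall x, (forall i, m i x) -> good_rad x.
have ex_spans : exists l, `[< spans l >].
  apply: contrapT => nsp.
  have step (I : set A^o) : exists m : set A^o,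
      ((exists m, maxgood m /\ ~ I `<=` m) -> maxgood m /\ ~ I `<=` m).
    by have [[m h]|h] := pselect (exists m, maxgood m /\ ~ I `<=` m);
      [exists m|exists set0].
  have [next nextP] := choice step.
  pose I := fix I k := if k is k'.+1 then I k' `&` next (I k') else setT.
  have IE k x : I k x <-> forall j, (j < k)%N -> next (I j) x.
    elim: k => [|k IH]; first by split.
    split=> [[/IH h hk] j|h]; first by rewrite ltnS leq_eqVlt => /predU1P[->|/h].
    by split; [apply/IH => j /ltnW; apply: h|apply: h].
  have nextG k : maxgood (next (I k)) /\ ~ I k `<=` next (I k).
    elim/ltn_ind: k => k IH; apply: nextP; apply: contrapT => h; apply: nsp.
    exists k; apply/asboolP; exists (fun i : 'I_k => next (I i)); split.
      by move=> i; case: (IH i (ltn_ord i)).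
    move=> x hx m mm; apply: contrapT => mx; apply: h; exists m; split=> // Im.
    by apply/mx/Im/IE => j jk; apply: (hx (Ordinal jk)).
  have [k hk] := nochain (fun k => next (I k)) (fun k => (nextG k).1).
  by case: (nextG k) => _; apply=> x /IE; apply: hk.
have [l /asboolP [m [mm mrad]] lmin] := ex_minnP ex_spans.
have ex_c i : exists c, (forall j, i != j -> m j c) /\ ~ m i c.
  apply: contrapT => h.
  case: l m mm mrad lmin i h => [|l] m mm mrad lmin i h; first by case: i {h}.
  suff : (l.+1 <= l)%N by rewrite ltnn.
  apply: lmin; apply/asboolP; exists (fun j => m (lift i j)); split=> // x hx.
  apply: mrad => j; have [<-|] := eqVneq i j; last first.
    by move=> ij; have [k ->] := unlift_some ij.
  apply: contrapT => mix; apply: h; exists x; split=> // k ik.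
  by have [k' ->] := unlift_some ik.
have [c cP] := choice ex_c.
have /choice[u uP] i : exists u : nat * A, mult u.1 /\ m i (u.1%:R - u.2 * c i).
  have [_ _ mmax] := mm i; have [mu [a [mmu h]]] := mmax _ 1 (cP i).2.
  by exists (mu, a).
(* Each index has its own multiplier; the cofactors bring them to a common one. *)
pose mu := (\prod_i (u i).1)%N.
pose cof i := (\prod_(j | j != i) (u j).1)%N.
have muE i : mu = ((u i).1 * cof i)%N by rewrite /mu (bigD1 i).
exists l, m, (fun i => ((u i).2 * c i) *+ cof i), mu; split=> //.
- by apply: mult_prod => i; case: (uP i).
- move=> i j ij; have mG := maxgood_good (mm j).
  by apply: (goodMn mG); apply: (goodZ mG); case: (cP i) => h _; apply: h.
- move=> i; have mG := maxgood_good (mm i); case: (uP i) => _ h.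
  by rewrite (muE i) natrM -mulr_natr -mulrBl mulr_natr -opprB mulNrn;
    apply: (goodN mG); apply: (goodMn mG).
Qed.
End Saturated.

(* A ring isomorphism from the opposite ring of A onto End(P), written as a
   right action of A on P. *)
Record end_action (A : pzRingType) (P : lmodType A) (rho : A -> {linear P -> P}) :
    Prop := EndAction {
  end_actionD : forall c d p, rho (c + d) p = rho c p + rho d p;
  end_action1 : forall p, rho 1 p = p;
  end_actionM : forall c d p, rho (c * d) p = rho d (rho c p);
  end_action_inj : forall c d, rho c =1 rho d -> c = d;
  end_action_surj : forall f : {linear P -> P}, exists c, f =1 rho c }.

(** * Submodules of P and left ideals of A *)

Section SubmoduleTransfer.
Variables (A : pzRingType) (P : lmodType A) (rho : A -> {linear P -> P}).
Hypotheses (rhoP : end_action rho) (P_dual : dual_basis P).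
Variables (b : bool) (n : nat).
Local Open Scope classical_set_scope.
Local Notation good := (@good A b n).
Local Notation maxgood := (@maxgood A b n).
Local Notation good_rad := (@good_rad A b n).
Implicit Types (I m : set A^o) (h : {linear P -> A^o}) (x y p : P).

Lemma rho0 p : rho 0 p = 0.
Proof. by apply: (addrI (rho 0 p)); rewrite -(end_actionD rhoP) !addr0. Qed.

Lemma rhoN c p : rho (- c) p = - rho c p.
Proof.
by apply: (addrI (rho c p)); rewrite -(end_actionD rhoP) !subrr rho0.
Qed.

Lemma rhoB c d p : rho (c - d) p = rho c p - rho d p.
Proof. by rewrite (end_actionD rhoP) rhoN. Qed.

Lemma rhoMn c k p : rho (c *+ k) p = rho c p *+ k.
Proof.
elim: k => [|k IH]; first by rewrite !mulr0n rho0.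
by rewrite !mulrS (end_actionD rhoP) IH.
Qed.

Lemma rho_nat k p : rho k%:R p = p *+ k.
Proof. by rewrite rhoMn (end_action1 rhoP). Qed.

Definition rk x h : A := projT1 (cid (end_action_surj rhoP (outer h x))).

Lemma rkE x h p : rho (rk x h) p = (h p : A) *: x.
Proof. by rewrite /rk; case: cid => c /= <-. Qed.

Lemma rkB x y h : rk (x - y) h = rk x h - rk y h.
Proof. by apply: (end_action_inj rhoP) => p; rewrite rhoB !rkE scalerBr. Qed.

Lemma rk0 h : rk 0 h = 0.
Proof. by apply: (end_action_inj rhoP) => p; rewrite rho0 rkE scaler0. Qed.

Lemma rkMn x k h : rk (x *+ k) h = rk x h *+ k.
Proof. by apply: (end_action_inj rhoP) => p; rewrite rhoMn !rkE scalerMnr. Qed.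

Lemma rk_rho x c h : rk (rho c x) h = rk x h * c.
Proof. by apply: (end_action_inj rhoP) => p; rewrite (end_actionM rhoP) !rkE linearZ. Qed.

Lemma rkZ a x h : rk (a *: x) h = rk x (mul_functional h a).
Proof. by apply: (end_action_inj rhoP) => p; rewrite !rkE scalerA. Qed.

Lemma rk_dual k (x : 'I_k -> P) (xi : 'I_k -> {linear P -> A^o}) :
  (forall p, p = \sum_i (xi i p : A) *: x i) -> \sum_i rk (x i) (xi i) = 1.
Proof.
move=> xE; apply: (end_action_inj rhoP) => p.
rewrite (big_morph (fun c => rho c p) (fun c d => end_actionD rhoP c d p) (rho0 p)).
by rewrite (end_action1 rhoP) [RHS]xE; apply: eq_bigr => i _; rewrite rkE.
Qed.

(* The submodule P I of P, with inverse [N |-> {c | P c <= N}]. *)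
Definition transfer I : set P := [set x | forall h, I (rk x h)].

Lemma transfer_good I : good I -> good (transfer I).
Proof.
move=> IG; rewrite /transfer; split=> /=.
- by move=> h; rewrite rk0; apply: (good0 IG).
- by move=> x y hx hy h; rewrite rkB; apply: (goodB IG).
- by move=> a x hx h; rewrite rkZ; apply: hx.
- by move=> mu x mmu hx h; apply: (goodS IG mmu); rewrite -rkMn.
- by move=> x h; rewrite rkMn; apply: (good_n IG).
Qed.

Lemma transfer_rho I c p : good I -> I c -> transfer I (rho c p).
Proof. by move=> IG Ic h; rewrite rk_rho; apply: (goodZ IG). Qed.

(** The dual basis writes 1 as a sum of [rk (x i) (xi i)], so [c] is the sum of the
    [rk (rho c (x i)) (xi i)], all in [I]. *)
Lemma transfer_rhoE I c : good I -> (forall p, transfer I (rho c p)) -> I c.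
Proof.
have [k [x [xi xE]]] := P_dual => IG h.
rewrite -[c]mul1r -(rk_dual xE) mulr_suml; apply: (good_sum IG) => i _.
by rewrite -rk_rho; apply: h.
Qed.

Lemma transfer_maxgood m : maxgood m -> maxgood (transfer m).
Proof.
move=> mm; have mG := maxgood_good mm; split; first exact: transfer_good.
  apply: contrapT => h; apply: (maxgood1 mm); apply: (transfer_rhoE mG) => p.
  by apply: contrapT => hp; apply: h; exists (rho 1 p).
move=> x y /existsNP[h hx].
have [_ _ mmax] := mm; have [mu [r [mmu hr]]] := mmax _ 1 hx.
(* [rho] reverses products: [rho (r * rk x h) y] is [rho (rk x h)] at [rho r y], that is
   [h (rho r y) *: x]. *)
exists mu, (h (rho r y)); split=> //.
have := transfer_rho y mG hr; rewrite rhoB rho_nat.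
by rewrite (end_actionM rhoP) rkE.
Qed.

Section Family.
Variables (l : nat) (m : 'I_l -> set A^o) (a : 'I_l -> A) (mu : nat).
Hypothesis fam : crt_family b n m a mu.
Local Notation N := (fun k => transfer (m k)).

Lemma family_sum (N' : set P) p : maxgood N' -> N' (\sum_i a i *: p - p *+ mu).
Proof.
move=> N'M; rewrite -scaler_suml -scaler_nat -scalerBl; apply: (rad_colon _ N'M).
apply: (crt_rad fam) => i; have mG := maxgood_good (crt_max fam i).
rewrite (bigD1 i) //= addrAC; apply: (goodD mG); first exact: crt_eq fam i.
by apply: (good_sum mG) => j ji; apply: (crt_neq fam).
Qed.

(** If [r] is in [m i], then [r * a i] is in every [m j], hence in the radical, and sends [z] into
    [N']; maximality of [m i] turns this inclusion into equality. *)
Lemma family_colon (N' : set P) z i : maxgood N' -> ~ N' (a i *: z) ->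
  forall r, N' (r *: (a i *: z)) <-> m i r.
Proof.
move=> N'M Nz; have [mM mG] := (crt_max fam i, maxgood_good (crt_max fam i)).
have sub : (m i `<=` colon N' (a i *: z)).
  move=> r mr; rewrite /colon /= scalerA; apply: (rad_colon _ N'M).
  apply: (crt_rad fam) => j; have [<-|ij] := eqVneq i j; last first.
    by apply: (goodZ (maxgood_good (crt_max fam j))); apply: (crt_neq fam).
  apply: (goodBr mG) (goodMn mG mu mr); rewrite -mulr_natr -mulrBr.
  by apply: (goodZ mG); apply: (crt_eq fam).
have sub' : (colon N' (a i *: z) `<=` m i).
  have cG := maxgood_good (colon_maxgood N'M Nz).
  by apply: (@maxgood_eq A b n A^o _ _ 1 mM cG sub); rewrite /colon /= scale1r.
by move=> r; split; [apply: sub'|apply: sub].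
Qed.

Lemma family_component (N' : set P) z : maxgood N' -> ~ N' z -> exists i, ~ N' (a i *: z).
Proof.
move=> N'M Nz; apply: contrapT => h; apply: Nz; have N'G := maxgood_good N'M.
apply: (goodS N'G (crt_mu fam)); apply: (goodBl N'G (family_sum z N'M)).
apply: (good_sum N'G) => i _; apply: contrapT => hi; apply: h.
by exists i.
Qed.

(** Together with [family_project]: up to the factor [mu], [rho (a k)] projects P modulo the
    intersection of the [N j] onto its k-th component. *)
Lemma family_separate x k j : k != j -> N j (rho (a k) x).
Proof.
move=> kj; apply: transfer_rho; last exact: (crt_neq fam).
exact: maxgood_good (crt_max fam j).
Qed.

Lemma family_project x k : N k (rho (a k) x - x *+ mu).
Proof.
rewrite -rho_nat -rhoB; apply: transfer_rho; last exact: (crt_eq fam).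
exact: maxgood_good (crt_max fam k).
Qed.
End Family.
End SubmoduleTransfer.

(** * Modules with the same top *)

Lemma nat_pigeonhole (X : finType) (f : nat -> X) :
  exists i j, (i < j)%N /\ f i = f j.
Proof.
have /injectivePn[i [j ij E]] : ~~ injectiveb (fun i : 'I_#|X|.+1 => f i).
  apply/negP => /injectiveP /leq_card; rewrite card_ord ltnn.
  by [].
by case: (ltngtP i j) ij => [h|h|/val_inj ->]; rewrite ?eqxx // => _;
  [exists i, j|exists j, i].
Qed.

Section Glue.
Variables (A : pzRingType) (J : A -> Prop).
Hypothesis J_mull : forall a c, J c -> J (a * c).
Hypothesis J_unit : forall c, J c -> exists d, d * (1 - c) = 1.

(** The left inverse [d] is itself 1 minus the element [- d * c] of [J], so it has a left inverse,
    which must be [1 - c]. *)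
Lemma quasi_regular c : J c -> exists d, d * (1 - c) = 1 /\ (1 - c) * d = 1.
Proof.
move=> Jc; have [d dE] := J_unit Jc; exists d; split=> //.
have dc : d = 1 - (- d) * c by rewrite mulNr opprK -{1}dE -mulrDr subrK mulr1.
have [e eE] := J_unit (J_mull (- d) Jc).
rewrite -dc in eE; have -> : 1 - c = e by rewrite -[LHS]mul1r -{1}eE -mulrA dE mulr1.
exact: eE.
Qed.

Section Small.
Variables (P : lmodType A) (rho : A -> {linear P -> P}).
Hypotheses (rhoP : end_action rho) (P_dual : dual_basis P).
Variables (I : Type) (m : I -> set A^o) (b : I -> bool) (n : I -> nat).
Hypothesis m_good : forall k, good (b k) (n k) (m k).
Hypothesis m_J : forall c, (forall k, m k c) -> J c.

(** Nakayama's lemma for [P]: [u] is [rho c] with [c] in all [m k], hence in [J]. *)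
Lemma small_endo (u : {linear P -> P}) :
  (forall p k, transfer rhoP (m k) (u p)) -> bijective (fun p => p - u p).
Proof.
have [c cE] := end_action_surj rhoP u => h.
have [|d [d1 d2]] := @quasi_regular c.
  apply: m_J => k; apply: (transfer_rhoE (rhoP := rhoP) P_dual (m_good k)) => p.
  by rewrite -cE.
have E p : p - u p = rho (1 - c) p by rewrite (rhoB rhoP) (end_action1 rhoP) cE.
exists (rho d) => p; rewrite E -(end_actionM rhoP) ?d1 ?d2; exact: end_action1.
Qed.
End Small.

Section Match.
Variables (I : Type) (b : I -> bool) (n e : I -> nat) (m : I -> set A^o).
Hypothesis e_mult : forall k, mult (b k) (e k).

(** Modulo [N k], the vector [p k] spans a copy of A modulo [m k] that contains [e k] times the
    image of P. *)
Record framed (P : lmodType A) (N : I -> set P) (p : I -> P) : Prop := Framed {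
  framed_good : forall k, good (b k) (n k) (N k);
  framed_small : forall u : {linear P -> P}, (forall x k, N k (u x)) ->
    bijective (fun x => x - u x);
  framed_colon : forall k r, N k (r *: p k) <-> m k r;
  framed_span : forall x, exists r, forall k, N k (x *+ e k - r k *: p k) }.

(** The image of P in the product of its quotients by the [N k], in coordinates with denominators
    [e k]. *)
Definition coords (P : lmodType A) (N : I -> set P) (p : I -> P) (r : I -> A) : Prop :=
  exists x, forall k, N k (x *+ e k - r k *: p k).

(** By the dual basis it suffices to match coordinates on the finitely many generators [x i]. *)
Lemma glue_lift (P P' : lmodType A) N p N' p' : dual_basis P ->
  @framed P N p -> @framed P' N' p' ->
  (forall r, coords N p r -> coords N' p' r) ->
  exists f : {linear P -> P'}, forall x, exists r, forall k,
    N k (x *+ e k - r k *: p k) /\ N' k (f x *+ e k - r k *: p' k).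
Proof.
move=> [s [x [xi xE]]] F F' sub.
have /choice[z zP] i : exists z, exists r, forall k,
    N k (x i *+ e k - r k *: p k) /\ N' k (z *+ e k - r k *: p' k).
  have [r rP] := framed_span F (x i).
  have [|z zP] := sub r; first by exists (x i).
  by exists z, r.
have flin : linear (fun q => \sum_i (xi i q : A) *: z i).
  move=> a q r; rewrite scaler_sumr -big_split /=; apply: eq_bigr => i _.
  by rewrite linearP scalerDl scalerA.
exists (mklin flin) => q; rewrite {1}(xE q) /=.
have [r rP] := choice zP.
exists (fun k => \sum_i (xi i q : A) * r i k) => k.
have [NG N'G] := (framed_good F k, framed_good F' k).
rewrite -!sumrMnl !scaler_suml -!sumrB; split.
  apply: (good_sum NG) => i _; rewrite -scalerA scalerMnr -scalerBr.
  by apply: (goodZ NG); case: (rP i k).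
apply: (good_sum N'G) => i _; rewrite -scalerA scalerMnr -scalerBr.
by apply: (goodZ N'G); case: (rP i k).
Qed.

(** [g \o f] is the identity modulo every [N k]: two coordinates of [f x] differ by an element of
    [m k], which sends [p k] into [N k] as it sends [p' k] into [N' k]. *)
Lemma glue_comp (P P' : lmodType A) N p N' p' (f : {linear P -> P'})
    (g : {linear P' -> P}) : @framed P N p -> @framed P' N' p' ->
  (forall x, exists r, forall k,
    N k (x *+ e k - r k *: p k) /\ N' k (f x *+ e k - r k *: p' k)) ->
  (forall x, exists r, forall k,
    N' k (x *+ e k - r k *: p' k) /\ N k (g x *+ e k - r k *: p k)) ->
  bijective (g \o f).
Proof.
move=> F F' fP gP.
have : bijective (fun x => x - (idfun \- (g \o f)) x).
  apply: (framed_small F) => x k; have NG := framed_good F k.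
  have [r rP] := fP x; have [s sP] := gP (f x).
  apply: (goodS NG (e_mult k)); rewrite /= mulrnBl.
  have [[r1 r2] [s1 s2]] := (rP k, sP k).
  have : N k ((r k - s k) *: p k).
    apply/(framed_colon F)/(framed_colon F'); rewrite scalerBl.
    by have := goodB (framed_good F' k) s1 r2; rewrite opprB addrC addrA subrK.
  rewrite scalerBl => h.
  have := goodD NG (goodB NG r1 s2) h.
  by rewrite opprB addrAC !addrA !subrK.
by move=> /eq_bij; apply=> x /=; rewrite opprB addrC subrK.
Qed.

Lemma glue (P P' : lmodType A) N p N' p' : dual_basis P -> dual_basis P' ->
  @framed P N p -> @framed P' N' p' ->
  (forall r, coords N p r <-> coords N' p' r) -> isomorphic P P'.
Proof.
move=> dP dP' F F' sub.
have [f fP] := glue_lift dP F F' (fun r => (sub r).1).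
have [g gP] := glue_lift dP' F' F (fun r => (sub r).2).
have [k1 gfK Kgf] := glue_comp F F' fP gP.
have [k2 fgK Kfg] := glue_comp F' F gP fP.
exists f; exists (k1 \o g) => x; first exact: gfK.
apply: (can_inj fgK); rewrite /=.
by rewrite (Kgf (g x) : g (f (k1 (g x))) = g x).
Qed.
End Match.
End Glue.

Section Frames.
Variables (A : pzRingType) (b : bool) (n l : nat) (m : 'I_l -> set A^o).
Variables (a : 'I_l -> A) (mu : nat).
Hypothesis fam : crt_family b n m a mu.

Definition local_frame (e : nat) (P : lmodType A) (N : set P) i p : Prop :=
  (forall r, N (r *: p) <-> m i r) /\ forall x, exists r, N (x *+ e - r *: p).

Lemma local_frame1 (P : lmodType A) (N : set P) : ~~ b -> maxgood b n N ->
  exists i p, local_frame 1 N i p.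
Proof.
move=> nb NM; have [_ [z Nz] Nmax] := NM.
have [i Ni] := family_component fam NM Nz.
exists i, (a i *: z); split; first exact: (family_colon fam NM Ni).
move=> x; have [nu [r [mnu h]]] := Nmax _ x Ni; exists r.
by move: mnu h; rewrite /mult (negPf nb) => /andP[_ /eqP->].
Qed.

Variables (P : lmodType A) (rho : A -> {linear P -> P}).
Hypotheses (rhoP : end_action rho) (P_dual : dual_basis P).
Local Notation N := (fun k => transfer rhoP (m k)).

(** Applying [rho (a k)] puts the k-th frame vector into the other [N j] and multiplies it by [mu]
    modulo [N k], whence the factor [mu]. *)
Lemma frame_exists e : (forall k, exists i p, local_frame e (N k) i p) ->
  exists (c : 'I_l -> 'I_l) p, [/\ forall k j, k != j -> N j (p k),
    forall k r, N k (r *: p k) <-> m (c k) r &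
    forall x, exists r : 'I_l -> A, forall k, N k (x *+ (e * mu) - r k *: p k)].
Proof.
move=> /choice[c /choice[p pP]].
have NG k := transfer_good rhoP (maxgood_good (crt_max fam k)).
have proj r k : N k (r *: rho (a k) (p k) - (r *: p k) *+ mu).
  by rewrite -linearZ; apply: (family_project rhoP fam).
exists c, (fun k => rho (a k) (p k)); split.
- by move=> k j kj; apply: (family_separate rhoP fam).
- move=> k r; split=> [h|/(pP k).1 h].
    apply/(pP k).1/(goodS (NG k) (crt_mu fam))/(goodBl (NG k)) /h.
    exact: proj.
  exact: (goodBr (NG k) (proj r k) (goodMn (NG k) mu h)).
- move=> x; have /choice[r rP] k := (pP k).2 x; exists r => k.
  have := goodMn (NG k) mu (rP k); rewrite mulrnBl -mulrnA => h.
  have := goodB (NG k) h (proj (r k) k).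
  by rewrite opprB addrA subrK.
Qed.
End Frames.

(** * Semilocal rings *)

Section Semilocal.
Variable R : pzRingType.
Local Notation A := R^c.
Local Open Scope classical_set_scope.

Lemma maxgood_maximal (m : set A^o) :
  maxgood false 0 m -> maximal_right_ideal (m : set R).
Proof.
move=> mm; have mG := maxgood_good mm; have [_ _ mmax] := mm.
split.
- split; [exact: good0 mG|by move=> x y; apply: (goodB mG)|].
  by move=> x r mx; apply: (goodZ mG (r : A) mx).
- by move=> mT; apply: (maxgood1 mm); rewrite [m]mT.
move=> J [J0 JB JZ] mJ.
have [Jm|/existsNP[x /not_implyP[Jx mx]]] := pselect (forall x, J x -> m x).
  by left; apply/seteqP; split.
right; apply/seteqP; split=> // y _.
have [mu [a [mmu h]]] := mmax x y mx.
move: mmu h; rewrite /mult /= => /andP[_ /eqP->]; rewrite mulr1n => h.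
have JN z : J z -> J (- z) by move=> Jz; rewrite -[- z]add0r; apply: JB.
rewrite -[y](subrK (a *: (x : A^o))) -[X in J (_ + X)]opprK.
by apply: JB; [apply: mJ|apply: JN; apply: (JZ x (a : R))].
Qed.

Lemma semilocal_crt_family : semilocal R ->
  exists l m a mu, @crt_family A false 0 l m a mu.
Proof.
move=> [B [pi [pi_surj pi_ker _ artinian]]]; apply: crt_family_exists => m mm.
pose I k : set R := [set x | forall j, (j < k)%N -> m j x].
have mG k := maxgood_good (mm k).
have [||k kP] := artinian (fun k => [set pi x | x in I k]).
- move=> k; split.
  + by exists 0; rewrite ?rmorph0 // => j _; apply: (good0 (mG j)).
  + move=> _ _ [x Ix <-] [y Iy <-]; exists (x - y); last by rewrite rmorphB.
    by move=> j jk; apply: (goodB (mG j)); [apply: Ix|apply: Iy].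
  + move=> _ r [x Ix <-]; have [s <-] := pi_surj r.
    exists (x * s); last by rewrite rmorphM.
    by move=> j jk; apply: (goodZ (mG j) (s : A) (Ix j jk)).
- move=> k _ [x Ix <-]; exists x => // j jk; apply: Ix.
  exact: ltn_trans jk _.
exists k => x Ix.
have : [set pi x | x in I k] (pi x) by exists x.
rewrite -(kP k.+1) // => -[y Iy E].
have my : m k y by apply: Iy.
(* Equal images suffice, because the kernel is the Jacobson radical and so lies in [m k]. *)
have /pi_ker /(_ _ (maxgood_maximal (mm k))) : pi (y - x) = 0.
  by rewrite rmorphB E subrr.
by move/(goodBl (mG k)); apply.
Qed.

Lemma semilocal_isomorphic (P : nat -> lmodType A) : semilocal R ->
  (forall i, dual_basis (P i)) ->
  (forall i, exists rho : A -> {linear P i -> P i}, end_action rho) ->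
  exists i j, (i < j)%N /\ isomorphic (P i) (P j).
Proof.
move=> /semilocal_crt_family[l [m [a [mu fam]]]] dP eP.
have mu1 : mu = 1%N by have := crt_mu fam; rewrite /mult /= => /andP[_ /eqP].
have mG k := maxgood_good (crt_max fam k).
have [rho rhoP] : exists rho : forall i, A -> {linear P i -> P i},
    forall i, end_action (rho i).
  by exists (fun i => projT1 (cid (eP i))) => i; case: cid.
have frames i : exists (c : {ffun 'I_l -> 'I_l}) p,
    (forall k j, k != j -> transfer (rhoP i) (m j) (p k)) /\
    framed (fun=> false) (fun=> 0) (fun=> 1%N) (fun k => m (c k))
      (fun k => transfer (rhoP i) (m k)) p.
  have [|c [p [F1 F2 F3]]] := frame_exists fam (rhoP := rhoP i) (e := 1).
    move=> k; apply: (local_frame1 fam) => //.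
    exact: (transfer_maxgood (rhoP i) (dP i) (crt_max fam k)).
  exists (finfun c), p; split=> //; split.
  - by move=> k; apply: transfer_good.
  - move=> u uP; have radU (y : A) : good_rad false 0 y -> exists d, d * (1 - y) = 1.
      move=> ry; have [|nu [d [w [mnu E]]]] := @unit_modulo A false 0 (1 - y).
        move=> m' mm' h; apply: (maxgood1 mm').
        by apply: (goodBr (maxgood_good mm') h); apply: ry.
      exists d; move: mnu E; rewrite /mult /= => /andP[_ /eqP->].
      by rewrite mulr0n addr0.
    exact: (small_endo (@rad_mull A false 0) radU (dP i) mG (crt_rad fam) uP).
  - by move=> k r; rewrite ffunE.
  - by move=> x; have [r rP] := F3 x; exists r => k; have := rP k; rewrite mu1.
have [c {}frames] := choice frames.
have [i [j [ij cE]]] := nat_pigeonhole c.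
exists i, j; split=> //.
have [[p [pN pF]] [q [qN qF]]] := (frames i, frames j); rewrite -cE in qF.
apply: (glue (fun=> mult1 false) (dP i) (dP j) pF qF) => r.
(* All multipliers are 1 here, so the image fills the product and [c] is the only invariant. *)
have all s (NG : forall k, good false 0 (transfer (rhoP s) (m k))) p' :
    (forall k j, k != j -> transfer (rhoP s) (m j) (p' k)) ->
    coords (fun=> 1%N) (fun k => transfer (rhoP s) (m k)) p' r.
  move=> p'N; exists (\sum_k r k *: p' k) => k.
  rewrite mulr1n (bigD1 k) //= addrAC subrr add0r; apply: (good_sum (NG k)) => t tk.
  by apply: (goodZ (NG k)); apply: p'N.
by split=> _; apply: all => // k; apply: transfer_good.
Qed.
End Semilocal.

(** * The Jordan-Zassenhaus theorem *)

Section Dirichlet.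
Import Order.TTheory Num.Theory.

Lemma det_norm_le (n : nat) (M : 'M[rat]_n) (eps : rat) :
  (forall i j, `|M i j| <= eps) -> `|\det M| <= n`!%:R * eps ^+ n.
Proof.
move=> h; apply: le_trans (ler_norm_sum _ _ _) _.
have -> : n`!%:R * eps ^+ n = \sum_(s : {perm 'I_n}) \prod_(i < n) eps.
  by rewrite sumr_const perm.card_Sn mulr_natl prodr_const card_ord.
apply: ler_sum => s _; rewrite normrM normrX normrN1 expr1n mul1r normr_prod.
by apply: ler_prod => i _; rewrite normr_ge0 h.
Qed.

(** Dirichlet's pigeonhole: two of [B ^ k + 1] multiples of [xi] have fractional parts in the same
    box of side 1/B. The bound [M] depends on the matrices only. *)
Lemma dirichlet_det (e k : nat) (X : 'I_k -> 'M[rat]_e) : (0 < e)%N ->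
  exists M, (0 < M)%N /\ forall xi : 'I_k -> rat, exists t (w : 'I_k -> int),
    (0 < t <= M)%N /\
    `|\det (\sum_i (t%:R * xi i - (w i)%:~R) *: X i)| < 1.
Proof.
move=> e0.
pose C := Num.bound (\sum_i \sum_a \sum_c `|X i a c|).
have XC i a c : `|X i a c| <= C%:R.
  have le1 (I : finType) (f : I -> rat) j : (forall i, 0 <= f i) -> f j <= \sum_i f i.
    by move=> f0; rewrite (bigD1 j) //= lerDl sumr_ge0.
  apply: le_trans (ltW (archi_boundP _)); last by do !apply: sumr_ge0 => ? _.
  have s0 a' c' : 0 <= \sum_a \sum_c `|X c' a c| :> rat by do !apply: sumr_ge0 => ? _.
  apply: le_trans (le1 _ (fun i => \sum_a \sum_c `|X i a c|) i _); last first.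
    by move=> j; do !apply: sumr_ge0 => ? _.
  apply: le_trans (le1 _ (fun a => \sum_c `|X i a c|) a _); last first.
    by move=> j; apply: sumr_ge0.
  by apply: (le1 _ (fun c => `|X i a c|)) => j; apply: normr_ge0.
(* [C] bounds the entries of the [X i], so those of the combination are at most eps = kC/B and the
   determinant is at most e! eps^e; this [B] gives e! eps < 1, and eps^e <= eps as e > 0. *)
pose B := (e`! * (k * C))%N.+1.
have B0 : 0 < B%:R :> rat by rewrite ltr0n.
exists (B ^ k)%N; split; first by rewrite expn_gt0.
move=> xi.
pose fr (t : nat) i : rat := t%:R * xi i - (Num.floor (t%:R * xi i))%:~R.
have fr0 t i : 0 <= fr t i by rewrite subr_ge0 floor_le.
have fr1 t i : fr t i < 1.
  by rewrite ltrBlDl -(rmorphD intr _ 1) floorD1_gt.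
pose cell (t : nat) i : nat := Num.trunc (B%:R * fr t i).
have cellP t i : (cell t i)%:R <= B%:R * fr t i < (cell t i).+1%:R.
  by apply: truncn_itv; rewrite mulr_ge0 ?ler0n.
have cellB t i : (cell t i < B)%N.
  have /andP[h _] := cellP t i; rewrite -(ltr_nat rat); apply: le_lt_trans h _.
  by rewrite -[X in _ < X]mulr1 ltr_pM2l.
pose g (t : 'I_(B ^ k).+1) : {ffun 'I_k -> 'I_B} := [ffun i => Ordinal (cellB t i)].
have /injectivePn[u [v uv E]] : ~~ injectiveb g.
  apply/negP => /injectiveP /leq_card.
  by rewrite card_ord card_ffun !card_ord ltnn.
wlog lt_uv : u v uv E / (u < v)%N.
  move=> H; case: (ltngtP u v) => [h|h|/val_inj h]; last by rewrite h eqxx in uv.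
    exact: (H u v).
  by apply: (H v u); rewrite 1?eq_sym.
exists (v - u)%N, (fun i => Num.floor (v%:R * xi i) - Num.floor (u%:R * xi i)).
split; first by rewrite subn_gt0 lt_uv (leq_trans (leq_subr _ _)) // -ltnS.
set Y := \sum_i _.
have cE i : cell u i = cell v i.
  by have /ffunP/(_ i) := E; rewrite !ffunE => /(congr1 val).
have small i : `|(v - u)%:R * xi i -
    (Num.floor (v%:R * xi i) - Num.floor (u%:R * xi i))%:~R| <= B%:R^-1.
  have -> : (v - u)%:R * xi i - (Num.floor (v%:R * xi i) - Num.floor (u%:R * xi i))%:~R
      = fr v i - fr u i.
    by rewrite (natrB _ (ltnW lt_uv)) rmorphB mulrBl /fr; ring.
  rewrite -(ler_pM2l B0) divff ?gt_eqF // -{1}(gtr0_norm B0) -normrM ltW //.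
  rewrite mulrBr ltr_norml; have := cellP u i; have := cellP v i; rewrite cE.
  by rewrite -natr1; move: (B%:R * _) (B%:R * _) => x y; lra.
have YE a c : `|Y a c| <= (k * C)%:R / B%:R.
  rewrite /Y summxE; apply: le_trans (ler_norm_sum _ _ _) _.
  apply: (@le_trans _ _ (\sum_(i < k) (B%:R^-1 * C%:R))).
    by apply: ler_sum => i _; rewrite mxE normrM ler_pM.
  by rewrite sumr_const card_ord -mulr_natl natrM; lra.
apply: le_lt_trans (det_norm_le YE) _.
set eps := _ / _; have eps0 : 0 <= eps by rewrite divr_ge0 ?ler0n.
have fe : e`!%:R * eps < 1.
  by rewrite mulrA -natrM ltr_pdivrMr // mul1r ltr_nat.
have eps1 : eps <= 1.
  apply: ltW; apply: le_lt_trans fe; rewrite ler_peMl // ler1n.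
  exact: fact_gt0.
apply: le_lt_trans fe; rewrite ler_wpM2l ?ler0n //.
by rewrite -(prednK e0) exprS ler_piMr // exprn_ile1.
Qed.
End Dirichlet.

Lemma common_denominator (I : finType) (v : I -> rat) :
  exists (D : nat) (z : I -> int), (0 < D)%N /\ forall i, D%:R * v i = (z i)%:~R.
Proof.
pose D := (\prod_i `|denq (v i)|)%N; exists D.
have den i : `|denq (v i)|%N%:R = (denq (v i))%:~R :> rat.
  by rewrite -[in RHS]absz_denq.
exists (fun i => numq (v i) *+ (\prod_(j | j != i) `|denq (v j)|)%N); split.
  by rewrite prodn_gt0 // => i; rewrite absz_gt0 denq_neq0.
move=> i; rewrite /D (bigD1 i) //= natrM mulrAC den.
by rewrite mulrC -[X in _ * X]mulrC -numqE rmorphMn mulr_natl.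
Qed.

Section GoodInt.
Variables (A : pzRingType) (b : bool) (n : nat) (M : lmodType A) (N : set M).
Hypothesis NG : good b n N.

Lemma goodMz x z : N x -> N (x *~ z).
Proof.
case: z => z Nx; first exact: (goodMn NG z Nx).
by rewrite NegzE mulrNz; apply: (goodN NG); apply: (goodMn NG z.+1 Nx).
Qed.
End GoodInt.

(** * The idealizer of a maximal saturated ideal *)

Section Idealizer.
Variables (A : pzRingType) (d : nat).
Hypothesis rank_le : forall k (a : 'I_k -> A), (d < k)%N ->
  exists z : 'I_k -> int, (exists i, z i <> 0) /\ \sum_i a i *~ z i = 0.
Variable m : set A^o.
Hypothesis mM : maxgood true 0 m.
Let mG := maxgood_good mM.

(** Modulo [m] this is the endomorphism ring of A/m, acting on the right. *)
Definition idealizer (c : A) : Prop := forall r : A, m r -> m (r * c).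

Lemma idealizer1 : idealizer 1.
Proof. by move=> r; rewrite mulr1. Qed.

Lemma idealizerD c c' : idealizer c -> idealizer c' -> idealizer (c + c').
Proof. by move=> h h' r mr; rewrite mulrDr; apply: (goodD mG); [apply: h|apply: h']. Qed.

Lemma idealizerMz c z : idealizer c -> idealizer (c *~ z).
Proof. by move=> h r mr; rewrite mulrzAr; apply: (goodMz mG); apply: h. Qed.

Lemma idealizerMn c k : idealizer c -> idealizer (c *+ k).
Proof. exact: (@idealizerMz c k). Qed.

Lemma idealizerM c c' : idealizer c -> idealizer c' -> idealizer (c * c').
Proof. by move=> h h' r /h /h'; rewrite mulrA. Qed.

Lemma idealizer_sum (I : finType) (c : I -> A) :
  (forall i, idealizer (c i)) -> idealizer (\sum_i c i).
Proof.
move=> h; apply: big_ind => //; last exact: idealizerD.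
by move=> r _; rewrite mulr0; apply: (good0 mG).
Qed.

Lemma idealizer_mem c : m c -> idealizer c.
Proof. by move=> mc r _; apply: (goodZ mG (r : A) mc). Qed.

Lemma idealizer_mul_mem c c' : m c -> m (c' * c).
Proof. exact: (goodZ mG). Qed.

Lemma rank_basis : exists e (b : 'I_e -> A), [/\ (0 < e)%N,
  forall i, idealizer (b i),
  forall z : 'I_e -> int, m (\sum_i b i *~ z i) -> forall i, z i = 0 &
  forall c, idealizer c ->
    exists (nu : nat) (z : 'I_e -> int), (0 < nu)%N /\ m (c *+ nu - \sum_i b i *~ z i)].
Proof.
pose free k := exists b : 'I_k -> A, (forall i, idealizer (b i)) /\
  forall z : 'I_k -> int, m (\sum_i b i *~ z i) -> forall i, z i = 0.
have free0 : `[< free 0%N >] by apply/asboolP; exists (fun=> 0); split=> [[]|? _ []].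
have free_le k : `[< free k >] -> (k <= d)%N.
  move=> /asboolP [b [_ bI]]; rewrite leqNgt; apply/negP => /(rank_le b)[z [[i zi] z0]].
  by apply: zi; apply: bI; rewrite z0; apply: (good0 mG).
have [e /asboolP [b [bO bI]] emax] :=
  ex_maxnP (ex_intro (fun k => `[< free k >]) 0%N free0) free_le.
have span c : idealizer c -> exists (nu : nat) (z : 'I_e -> int),
    (0 < nu)%N /\ m (c *+ nu - \sum_i b i *~ z i).
  move=> cO; pose b' (i : 'I_e.+1) := oapp b c (unlift ord0 i).
  have [z] : exists z : 'I_e.+1 -> int, m (\sum_i b' i *~ z i) /\ exists i, z i <> 0.
    apply: contrapT => h; suff : (e.+1 <= e)%N by rewrite ltnn.
    apply: emax; apply/asboolP; exists b'; split.
      by move=> i; rewrite /b'; case: unliftP => [j|] _ /=; [apply: bO|].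
    move=> z mz i; apply: contrapT => zi; apply: h; exists z; split=> //.
    by exists i.
  rewrite big_ord_recl /b' unlift_none /=.
  under eq_bigr do rewrite liftK /=.
  move=> [mz [i zi]].
  have z0 : z ord0 <> 0.
    move=> z0; apply: zi; case: (unliftP ord0 i) => [j|] -> //.
    by apply: (bI (fun j => z (lift ord0 j))); move: mz; rewrite z0 mulr0z add0r.
  case: (z ord0) z0 mz => k; first move=> k0 mz.
    exists k, (fun i => - z (lift ord0 i)); split; first by case: k k0 {mz}.
    by under eq_bigr do rewrite mulrNz; rewrite sumrN opprK.
  rewrite NegzE => _ /(goodN mG); rewrite mulrNz opprD opprK => mz.
  by exists k.+1, (fun i => z (lift ord0 i)).
exists e, b; split=> //; rewrite lt0n; apply/eqP => e0.
have [nu [z [nu0 h]]] := span 1 idealizer1.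
apply: (maxgood_mu mM (mu := nu)); first by rewrite /mult nu0.
apply: (goodBr mG h); rewrite big1 => [|i _]; first exact: good0 mG.
by have := ltn_ord i; rewrite {2}e0.
Qed.

(** Scaling a basis by a common denominator [D] of its structure constants makes them integral, as
    products scale by the square of [D]. *)
Lemma order_basis : exists e (b : 'I_e -> A) (gam : 'I_e -> 'I_e -> 'I_e -> int),
 [/\ (0 < e)%N, forall i, idealizer (b i),
  forall z : 'I_e -> int, m (\sum_i b i *~ z i) -> forall i, z i = 0,
  forall c, idealizer c ->
    exists (nu : nat) (z : 'I_e -> int), (0 < nu)%N /\ m (c *+ nu - \sum_i b i *~ z i) &
  forall i j, m (b i * b j - \sum_l b l *~ gam i j l)].
Proof.
have [e [b [e0 bO bI span]]] := rank_basis.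
have /choice[u uP] (ij : 'I_e * 'I_e) : exists u : nat * ('I_e -> int),
    (0 < u.1)%N /\ m ((b ij.1 * b ij.2) *+ u.1 - \sum_l b l *~ u.2 l).
  have [nu [z h]] := span _ (idealizerM (bO ij.1) (bO ij.2)).
  by exists (nu, z).
pose D := (\prod_ij (u ij).1)%N.
pose cof ij := (\prod_(kl | kl != ij) (u kl).1)%N.
have D0 : (0 < D)%N by apply: prodn_gt0 => ij; case: (uP ij).
have DE ij : D = ((u ij).1 * cof ij)%N by rewrite /D (bigD1 ij).
exists e, (fun i => b i *+ D), (fun i j l => (u (i, j)).2 l *+ cof (i, j)).
split=> //.
- by move=> i; apply: idealizerMn.
- move=> z mz i.
  have Dz : D%:Z * z i = 0.
    apply: (bI (fun i => D%:Z * z i)); move: mz; congr (m _).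
    by apply: eq_bigr => j _; rewrite pmulrn mulrzA.
  by move/eqP: Dz; rewrite mulf_eq0 eqz_nat (gtn_eqF D0) /= => /eqP.
- move=> c cO; have [nu [z [nu0 h]]] := span c cO.
  exists (nu * D)%N, z; split; first by rewrite muln_gt0 nu0.
  have := goodMn mG D h; rewrite mulrnBl -mulrnA -sumrMnl; congr (m (_ - _)).
  by apply: eq_bigr => i _; rewrite !pmulrn mulrzAC.
- move=> i j; have [_ h] := uP (i, j).
  have := goodMn mG (cof (i, j) * D)%N h; rewrite mulrnBl -sumrMnl; congr (m (_ - _)).
    rewrite mulrnAl mulrnAr -!mulrnA; congr (_ *+ _).
    by rewrite mulnA -DE.
  apply: eq_bigr => l _; rewrite !pmulrn -!mulrzA; congr (_ *~ _).
  by rewrite PoszM; ring.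
Qed.
End Idealizer.

(** * Matrices of right multiplication on the idealizer modulo m *)

Section CommutantMatrices.
Import Num.Theory.
Variables (A : pzRingType) (m : set A^o).
Hypothesis mM : maxgood true 0 m.
Variables (e : nat) (b : 'I_e -> A).
Hypothesis bO : forall i, idealizer m (b i).
Hypothesis b_free : forall z : 'I_e -> int, m (\sum_i b i *~ z i) -> forall i, z i = 0.
Hypothesis b_span : forall c, idealizer m c ->
  exists (nu : nat) (z : 'I_e -> int), (0 < nu)%N /\ m (c *+ nu - \sum_i b i *~ z i).
Let mG := maxgood_good mM.
Local Notation O := (idealizer m).

Fact mcoord_ex c : exists u : nat * ('I_e -> int),
  O c -> (0 < u.1)%N /\ m (c *+ u.1 - \sum_i b i *~ u.2 i).
Proof.
have [/b_span[nu [z h]]|h] := pselect (O c); first by exists (nu, z).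
by exists (0%N, fun=> 0).
Qed.

(* Coordinates in the basis b of the Q-space spanned by the idealizer of m
   modulo m. *)
Definition mcoord c : 'rV[rat]_e :=
  let u := projT1 (cid (mcoord_ex c)) in \row_i ((u.2 i)%:~R / u.1%:R).

Lemma comb_mod (nu nu' : nat) c (z z' : 'I_e -> int) :
  m (c *+ nu - \sum_i b i *~ z i) -> m (c *+ nu' - \sum_i b i *~ z' i) ->
  forall i, z i * nu' = z' i * nu.
Proof.
move=> h h' i; apply/eqP; rewrite -subr_eq0; apply/eqP.
apply: (b_free (z := fun i => z i * nu' - z' i * nu)).
have := goodB mG (goodMn mG nu h') (goodMn mG nu' h).
rewrite !mulrnBl -!mulrnA [(nu' * nu)%N]mulnC opprB addrC addrA subrK.
rewrite -!sumrMnl -sumrB; congr (m _); apply: eq_bigr => j _.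
by rewrite mulrzBr !pmulrn !mulrzA.
Qed.

Lemma mcoordE c (nu : nat) (z : 'I_e -> int) : O c -> (0 < nu)%N ->
  m (c *+ nu - \sum_i b i *~ z i) -> mcoord c = \row_i ((z i)%:~R / nu%:R).
Proof.
move=> cO nu0 h; rewrite /mcoord; case: cid => -[k y] /= /(_ cO) [k0 hy].
apply/rowP => i; rewrite !mxE; apply/eqP.
have [k1 n1] : k%:R != 0 :> rat /\ nu%:R != 0 :> rat by rewrite !pnatr_eq0 -!lt0n.
rewrite eqr_div // [nu%:R]pmulrn [k%:R]pmulrn -!intrM.
by rewrite (comb_mod hy h).
Qed.

Lemma mcoordP c : O c -> exists (nu : nat) (z : 'I_e -> int),
  [/\ (0 < nu)%N, m (c *+ nu - \sum_i b i *~ z i) & mcoord c = \row_i ((z i)%:~R / nu%:R)].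
Proof.
move=> cO; have [nu [z [nu0 h]]] := b_span cO.
by exists nu, z; split=> //; apply: mcoordE.
Qed.

Lemma mcoordD c c' : O c -> O c' -> mcoord (c + c') = mcoord c + mcoord c'.
Proof.
move=> cO c'O; have [nu [z [nu0 h ->]]] := mcoordP cO.
have [nu' [z' [nu'0 h' ->]]] := mcoordP c'O.
rewrite (@mcoordE _ (nu * nu')%N (fun i => z i * nu' + z' i * nu)).
- apply/rowP => i; rewrite !mxE intrD !intrM natrM.
  have [n1 n2] : nu%:R != 0 :> rat /\ nu'%:R != 0 :> rat.
    by rewrite !pnatr_eq0 -!lt0n.
  by rewrite addf_div // -!pmulrn.
- exact: idealizerD.
- by rewrite muln_gt0 nu0.
have := goodD mG (goodMn mG nu' h) (goodMn mG nu h').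
rewrite !mulrnBl -!mulrnA [(nu' * nu)%N]mulnC addrACA -mulrnDl -opprD.
congr (m (_ - _)); rewrite -!sumrMnl -big_split; apply: eq_bigr => i _ /=.
by rewrite mulrzDr !pmulrn !mulrzA.
Qed.

Lemma mcoordMz c z : O c -> mcoord (c *~ z) = z%:~R *: mcoord c.
Proof.
move=> cO; have [nu [y [nu0 h ->]]] := mcoordP cO.
rewrite (@mcoordE _ nu (fun i => y i * z)) //; first 1 last.
- exact: (idealizerMz mM).
- have := goodMz mG z h; rewrite mulrzBl mulrz_suml pmulrn mulrzAC -pmulrn.
  by congr (m (_ - _)); apply: eq_bigr => i _; rewrite mulrzA.
by apply/rowP => i; rewrite !mxE intrM mulrCA mulrA.
Qed.

Lemma mcoord_eq0 c : O c -> mcoord c = 0 <-> m c.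
Proof.
move=> cO; split=> [|mc]; last first.
  rewrite (@mcoordE _ 1 (fun=> 0)) //; first by apply/rowP => i; rewrite !mxE mul0r.
  by rewrite big1 ?subr0.
have [nu [z [nu0 h ->]]] := mcoordP cO => /rowP h0.
have z0 i : z i = 0.
  have /eqP := h0 i; rewrite !mxE mulf_eq0 invr_eq0 pnatr_eq0 (gtn_eqF nu0) orbF.
  by rewrite intr_eq0 => /eqP.
apply: (goodS mG (mu := nu)); first by rewrite /mult nu0.
by move: h; rewrite big1 ?subr0 // => i _; rewrite z0.
Qed.

Lemma mcoord_mod c c' : O c -> O c' -> m (c - c') -> mcoord c = mcoord c'.
Proof.
move=> cO c'O h; rewrite -[c](subrK c') mcoordD //; last exact: idealizer_mem.
have -> : mcoord (c - c') = 0 by apply/mcoord_eq0 => //; apply: idealizer_mem.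
by rewrite add0r.
Qed.

Lemma mcoord_sum (I : finType) (c : I -> A) (z : I -> int) : (forall i, O (c i)) ->
  mcoord (\sum_i c i *~ z i) = \sum_i (z i)%:~R *: mcoord (c i).
Proof.
move=> cO; pose K a v := O a /\ mcoord a = v.
suff [] : K (\sum_i c i *~ z i) (\sum_i (z i)%:~R *: mcoord (c i)) by [].
apply: big_ind2 => [|x1 x2 y1 y2 [h1 <-] [h2 <-]|i _].
- split; first by apply: idealizer_mem => //; apply: good0 mG.
  by apply/mcoord_eq0; [apply: idealizer_mem => //|]; apply: good0 mG.
- by split; [apply: idealizerD|rewrite mcoordD].
- by split; [apply: idealizerMz|rewrite mcoordMz].
Qed.

Lemma mcoord_b i : mcoord (b i) = delta_mx 0 i.
Proof.
rewrite (@mcoordE _ 1 (fun j => (j == i)%:R)) //; last first.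
  rewrite mulr1n (bigD1 i) //= eqxx big1 => [|j /negPf->]; last by [].
  by rewrite addr0 subrr; apply: good0 mG.
by apply/rowP => j; rewrite !mxE eqxx /=; case: (j == i).
Qed.

Definition rmul_mx c : 'M[rat]_e := \matrix_i mcoord (b i * c).

Lemma mcoordM a c : O a -> O c -> mcoord (a * c) = mcoord a *m rmul_mx c.
Proof.
move=> aO cO; have [nu [z [nu0 h ->]]] := mcoordP aO.
have nu0' : nu%:R != 0 :> rat by rewrite pnatr_eq0 -lt0n.
apply: (scalerI nu0'); rewrite scalemxAl -[LHS](mcoordMz nu (idealizerM aO cO)) -pmulrn.
rewrite (@mcoord_mod _ (\sum_i (b i * c) *~ z i)).
- rewrite mcoord_sum => [|i]; last exact: idealizerM.
  rewrite mulmx_sum_row; apply: eq_bigr => i _; rewrite rowK !mxE.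
  by rewrite mulrC divfK.
- exact: (idealizerMn mM _ (idealizerM aO cO)).
- by apply: idealizer_sum => // i; apply: (idealizerMz mM); apply: idealizerM.
have := cO _ h; rewrite mulrBl mulrnAl mulr_suml; congr (m (_ - _)).
by apply: eq_bigr => i _; rewrite mulrzAl.
Qed.

Lemma rmul_mxM a c : O a -> O c -> rmul_mx (a * c) = rmul_mx a *m rmul_mx c.
Proof.
move=> aO cO; apply/row_matrixP => i; rewrite row_mul !rowK mulrA.
by apply: mcoordM => //; apply: idealizerM.
Qed.

Lemma rmul_mx_mod c c' : O c -> O c' -> m (c - c') -> rmul_mx c = rmul_mx c'.
Proof.
move=> cO c'O h; apply/row_matrixP => i; rewrite !rowK.
apply: mcoord_mod; [exact: idealizerM|exact: idealizerM|].
by rewrite -mulrBr; apply: idealizer_mul_mem.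
Qed.

Lemma rmul_mx_sum (I : finType) (c : I -> A) (z : I -> int) : (forall i, O (c i)) ->
  rmul_mx (\sum_i c i *~ z i) = \sum_i (z i)%:~R *: rmul_mx (c i).
Proof.
move=> cO; apply/row_matrixP => j; rewrite rowK mulr_sumr linear_sum.
under eq_bigr do rewrite mulrzAr.
rewrite mcoord_sum => [|i]; last exact: idealizerM.
by apply: eq_bigr => i _; rewrite linearZ /= rowK.
Qed.

Lemma rmul_mxMn c k : O c -> rmul_mx (c *+ k) = k%:R *: rmul_mx c.
Proof.
move=> cO; apply/row_matrixP => j; rewrite rowK mulrnAr linearZ /= rowK.
by rewrite pmulrn mcoordMz //; apply: idealizerM.
Qed.

Lemma rmul_mxB c c' : O c -> O c' -> rmul_mx (c - c') = rmul_mx c - rmul_mx c'.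
Proof.
move=> cO c'O; have NO : O (- c') by have := idealizerMz mM (-1) c'O; rewrite mulrN1z.
apply/row_matrixP => j; rewrite linearB /= !rowK mulrBr mcoordD; last 2 first.
- exact: idealizerM.
- by rewrite -mulrN; apply: idealizerM.
congr (_ + _); rewrite -[- (b j * c')]mulrN1z mcoordMz; last exact: idealizerM.
by rewrite scaleN1r.
Qed.

Lemma rmul_mx_coord c : O c -> rmul_mx c = \sum_i mcoord c 0 i *: rmul_mx (b i).
Proof.
move=> cO; have [nu [z [nu0 h ->]]] := mcoordP cO.
have nu0' : nu%:R != 0 :> rat by rewrite pnatr_eq0 -lt0n.
apply: (scalerI nu0'); rewrite -rmul_mxMn // scaler_sumr.
rewrite (rmul_mx_mod _ _ h); last 2 first.
- exact: (idealizerMn mM).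
- by apply: idealizer_sum => // i; apply: (idealizerMz mM).
rewrite rmul_mx_sum //; apply: eq_bigr => i _.
by rewrite mxE scalerA mulrC divfK.
Qed.

(** Schur's lemma: the idealizer modulo [m] becomes a division algebra over Q. A left kernel vector,
    cleared of denominators, is an [a] with [a * c] in [m]; if [c] is not in [m], maximality puts
    [a] in [m], so the vector is zero. *)
Lemma rmul_mx_det c : O c -> \det (rmul_mx c) = 0 -> m c.
Proof.
move=> cO /eqP/det0P[v v0 vc]; apply: contrapT => mc.
have [D [z [D0 zE]]] := common_denominator (fun i => v 0 i).
pose a := \sum_i b i *~ z i.
have aO : O a by apply: idealizer_sum => // i; apply: (idealizerMz mM).
have aE : mcoord a = D%:R *: v.
  rewrite mcoord_sum // [in RHS](row_sum_delta v) scaler_sumr.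
  by apply: eq_bigr => i _; rewrite scalerA zE mcoord_b.
have mac : m (a * c).
  by apply/mcoord_eq0; [apply: idealizerM|rewrite mcoordM // aE -scalemxAl vc scaler0].
have cG := maxgood_good (colon_maxgood mM mc).
have ma : m a.
  apply: (@maxgood_eq A true 0 A^o _ _ 1 mM cG) => //.
  by rewrite /colon /= scale1r.
have /eqP := (mcoord_eq0 aO).2 ma; rewrite aE scaler_eq0 (negPf v0) orbF.
by rewrite pnatr_eq0 (gtn_eqF D0).
Qed.
End CommutantMatrices.

Lemma telescope (V : zmodType) (x y z t u : V) :
  x - y + (y - z) - (x - t) - (t - u) = u - z.
Proof.
rewrite addrA subrK !opprB (addrC (x - z)) [t - x + (x - z)]addrA subrK.
by rewrite (addrC (t - z)) addrA subrK.
Qed.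

Section JordanZassenhaus.
Import Order.TTheory Num.Theory.
Variables (A : pzRingType) (d : nat).
Hypothesis rank_le : forall k (a : 'I_k -> A), (d < k)%N ->
  exists z : 'I_k -> int, (exists i, z i <> 0) /\ \sum_i a i *~ z i = 0.

Section MaximalSubmodule.
Variables (m : set A^o) (P : lmodType A) (N : set P).
Hypotheses (mM : maxgood true 0 m) (NM : maxgood true 0 N).
Let mG := maxgood_good mM.
Let NG := maxgood_good NM.

Lemma colon_eq (p : P) : ~ N p -> (forall r : A, m r -> N (r *: p)) ->
  forall r : A, N (r *: p) <-> m r.
Proof.
move=> Np sub r; split; last exact: sub.
have cG := maxgood_good (colon_maxgood NM Np).
apply: (@maxgood_eq A true 0 A^o _ (colon N p) 1 mM cG) => //.
by rewrite /colon /= scale1r.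
Qed.

Lemma colon_notin (p : P) : (forall r : A, N (r *: p) <-> m r) -> ~ N p.
Proof. by move=> h; rewrite -[p]scale1r => /h; apply: maxgood1 mM. Qed.

(** Modulo [N], [y] is a fraction a/nu of [p]; as [m] kills both, [a] lies in the idealizer. *)
Lemma colon_quotient (p y : P) : (forall r : A, N (r *: p) <-> m r) ->
  (forall r : A, m r -> N (r *: y)) ->
  exists nu a, [/\ (0 < nu)%N, idealizer m a & N (y *+ nu - a *: p)].
Proof.
move=> hp hy; have [_ _ Nmax] := NM.
have [nu [a [/andP[nu0 _] h]]] := Nmax _ y (colon_notin hp).
exists nu, a; split=> // r mr; apply/hp; rewrite -scalerA.
apply: (goodBl NG _ (goodMn NG nu (hy r mr))).
by rewrite scalerMnr -scalerBr; apply: (goodZ NG).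
Qed.
End MaximalSubmodule.

(* Some multiple of the lattice spanned by the g t lies in a cyclic submodule
   A p, with a multiplier independent of the lattice: take p minimizing the
   absolute value of the determinant, and divide by p with Dirichlet remainder. *)
Lemma cyclic_multiple (m : set A^o) : maxgood true 0 m ->
  exists e, (0 < e)%N /\ forall (P : lmodType A) (N : set P) (y0 : P),
    maxgood true 0 N -> (forall r : A, N (r *: y0) <-> m r) ->
    forall T (g : 'I_T -> P), (forall t (r : A), m r -> N (r *: g t)) ->
    exists p, (forall r : A, N (r *: p) <-> m r) /\
      forall t, exists r : A, N (g t *+ e - r *: p).
Proof.
move=> mM; have mG := maxgood_good mM.
have [e [b [gam [e0 bO bfree bspan bb]]]] := order_basis rank_le mM.
have [M [M0 dirichlet]] := dirichlet_det (rmul_mx bspan \o b) e0.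
have [nu1 [z1 [nu10 one]]] := bspan _ (@idealizer1 _ m).
pose X := rmul_mx bspan.
(* Modulo [m], [nu1] is a combination of the [b i], so it brings [g t] into the lattice spanned by
   all [b i *: g t]; the factorial of [M] is divisible by every Dirichlet multiplier. *)
exists (nu1 * M`!)%N; split; first by rewrite muln_gt0 nu10 fact_gt0.
move=> P N y0 NM y0m T g gm; have NG := maxgood_good NM.
have [gN|/existsNP[t0 gt0]] := pselect (forall t, N (g t)).
  by exists y0; split=> // t; exists 0; rewrite scale0r subr0; apply: (goodMn NG).
pose J := ('I_e * 'I_T)%type; pose h (j : J) := b j.1 *: g j.2.
have hm j (r : A) : m r -> N (r *: h j).
  by move=> mr; rewrite scalerA; apply: gm; apply: bO.
have /choice[u uP] (j : J) : exists u : nat * A,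
    [/\ (0 < u.1)%N, idealizer m u.2 & N (h j *+ u.1 - u.2 *: y0)].
  by have [nu [a H]] := colon_quotient mM NM y0m (hm j); exists (nu, a).
pose D := (\prod_j (u j).1)%N.
pose cof j := (\prod_(k | k != j) (u k).1)%N.
have D0 : (0 < D)%N by apply: prodn_gt0 => j; case: (uP j).
have DE j : D = ((u j).1 * cof j)%N by rewrite /D (bigD1 j).
pose a j := (u j).2 *+ cof j.
have aO j : idealizer m (a j) by case: (uP j) => _ H _; apply: idealizerMn.
have aE j : N (h j *+ D - a j *: y0).
  have [_ _ H] := uP j; have := goodMn NG (cof j) H.
  by rewrite mulrnBl -mulrnA -DE [_ *: y0 *+ _]scalerMnl.
pose y (z : J -> int) := \sum_j h j *~ z j.
pose c (z : J -> int) := \sum_j a j *~ z j.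
have cO z : idealizer m (c z).
  by apply: idealizer_sum => // j; apply: (idealizerMz mM).
have ym z (r : A) : m r -> N (r *: y z).
  move=> mr; rewrite scaler_sumr; apply: (good_sum NG) => j _.
  by rewrite -scalerMzr; apply: (goodMz NG); apply: hm.
have yc z : N (y z *+ D - c z *: y0).
  rewrite -sumrMnl scaler_suml -sumrB; apply: (good_sum NG) => j _.
  by rewrite -scalerMzl pmulrn mulrzAC -pmulrn -mulrzBl; apply: (goodMz NG).
(* The lattice modulo [N]. Integrality of [gam] makes it stable under the [b k], which keeps
   Dirichlet remainders inside it. *)
pose L x := exists z, N (x - y z).
have Lh j : L (h j).
  exists (fun k => (k == j)%:R); rewrite /y (bigD1 j) //= eqxx big1 => [|k /negPf-> //].
  by rewrite addr0 mulr1z subrr; apply: (good0 NG).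
have LD x x' : L x -> L x' -> L (x + x').
  move=> [z Hz] [z' Hz']; exists (fun j => z j + z' j).
  have := goodD NG Hz Hz'; rewrite addrACA -opprD -big_split /=.
  by congr (N (_ - _)); apply: eq_bigr => j _; rewrite mulrzDr.
have LMz x k : L x -> L (x *~ k).
  move=> [z Hz]; exists (fun j => z j * k); have := goodMz NG k Hz.
  rewrite mulrzBl mulrz_suml; congr (N (_ - _)).
  by apply: eq_bigr => j _; rewrite mulrzA.
have L0 : L 0 by exists (fun=> 0); rewrite /y big1 // subrr; apply: (good0 NG).
have Lmod x x' : N (x - x') -> L x' -> L x.
  by move=> Hx [z Hz]; exists z; have := goodD NG Hx Hz; rewrite addrA subrK.
have Lsum (I : finType) (x : I -> P) : (forall i, L (x i)) -> L (\sum_i x i).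
  by move=> H; apply: big_ind.
have Lb k x : L x -> L (b k *: x).
  case=> z Hz; apply: (Lmod _ (b k *: y z)).
    by rewrite -scalerBr; apply: (goodZ NG).
  rewrite scaler_sumr; apply: (Lsum) => j; rewrite -scalerMzr; apply: (LMz).
  apply: (Lmod _ (\sum_l h (l, j.2) *~ gam k j.1 l)); last first.
    by apply: (Lsum) => l; apply: (LMz).
  have := gm j.2 _ (bb k j.1); rewrite scalerBl scaler_suml scalerA.
  by congr (N (_ - _)); apply: eq_bigr => l _; rewrite scalerMzl.
(* Clearing denominators makes the determinants integers, so that a least absolute value is
   attained. *)
have [E [w [E0 wE]]] := common_denominator
  (fun v : J * ('I_e * 'I_e) => X (a v.1) v.2.1 v.2.2).
pose W z : 'M[int]_e := \matrix_(r, s) \sum_j z j * w (j, (r, s)).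
have WE z : E%:R *: X (c z) = map_mx intr (W z).
  rewrite /X rmul_mx_sum //; apply/matrixP => r s; rewrite !mxE summxE mulr_sumr rmorph_sum.
  apply: eq_bigr => j _; rewrite mxE rmorphM mulrCA; congr (_ * _); exact: (wE (j, (r, s))).
have exz : exists z, ~ N (y z).
  exists (fun j => if j.2 == t0 then z1 j.1 else 0) => Ny; apply: gt0.
  have Ny' : N (g t0 *+ nu1).
    have := gm t0 _ one; rewrite scalerBl -scalerMnl scale1r scaler_suml => H.
    apply: (goodBr NG H); move: Ny; congr N.
    rewrite /y -(pair_bigA _ (fun i t => h (i, t) *~ (if t == t0 then z1 i else 0))) /=.
    apply: eq_bigr => i _; rewrite (bigD1 t0) //= eqxx big1 => [|t /negPf-> //].
    by rewrite addr0 /h /= scalerMzl.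
  by apply: (goodS NG _ Ny'); rewrite /mult nu10.
pose Q k := `[< exists z, ~ N (y z) /\ `|\det (W z)|%N = k >].
have exQ : exists k, Q k.
  by have [z Hz] := exz; exists `|\det (W z)|%N; apply/asboolP; exists z.
have [k0 /asboolP[z [Nz zk]] kmin] := ex_minnP exQ.
pose p := y z; have pm := colon_eq mM NM Nz (ym z).
have step x : L x -> exists s (r : A), (0 < s <= M)%N /\ N (x *+ s - r *: p).
  move=> Lx; have xm (r : A) : m r -> N (r *: x).
    case: Lx => z' Hz' mr; apply: (goodBr NG _ (ym z' r mr)).
    by rewrite -scalerBr; apply: (goodZ NG).
  have [nu [q [nu0 qO Hq]]] := colon_quotient mM NM pm xm.
  have nu0' : nu%:R != 0 :> rat by rewrite pnatr_eq0 -lt0n.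
  (* [q / nu] is the fraction x/p. By [small], the remainder [x'] has a determinant of smaller
     absolute value than [p], so minimality puts it in [N]. *)
  have [s [v [sM small]]] := dirichlet (fun i => mcoord bspan q 0 i / nu%:R).
  exists s, (\sum_i b i *~ v i); split=> //.
  pose f := q *+ s - (\sum_i b i *~ v i) *+ nu.
  set x' := x *+ s - _.
  have bvO : idealizer m (\sum_i b i *~ v i).
    by apply: idealizer_sum => // i; apply: (idealizerMz mM).
  have [z' Hz'] : L x'.
    apply: (LD); first by rewrite pmulrn; apply: (LMz).
    rewrite -mulrN1z; apply: (LMz); rewrite scaler_suml; apply: Lsum => i.
    by rewrite -scalerMzl; apply/LMz/Lb; exists z; rewrite subrr; apply: (good0 NG).
  apply: contrapT => Nx'.
  have Nz' : ~ N (y z') by move/(goodBr NG Hz').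
  have H1 : N (x' *+ nu - f *: p).
    have := goodMn NG s Hq; congr N; rewrite /x' /f scalerBl !mulrnBl -!scalerMnl.
    by rewrite [x *+ nu *+ s]mulrnAC opprB addrA subrK.
  have fO : idealizer m f.
    apply: (idealizerD mM); first exact: (idealizerMn mM).
    by rewrite -mulrN1z; apply: (idealizerMz mM); apply: (idealizerMn mM).
  have H2 : m (c z' *+ nu - f * c z).
    apply/y0m; rewrite scalerBl -scalerMnl -scalerA.
    have G1 := goodMn NG nu (yc z').
    have G2 := goodMn NG (nu * D) Hz'.
    have G3 := goodMn NG D H1.
    have G4 := goodZ NG f (yc z).
    have := goodB NG (goodB NG (goodD NG G3 G4) G2) G1; congr N.
    rewrite mulnC !mulrnBl scalerBr -scalerMnr -!mulrnA [(D * nu)%N]mulnC.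
    exact: telescope.
  have H3 : nu%:R *: map_mx intr (W z') = X f *m map_mx intr (W z) :> 'M[rat]_e.
    rewrite -!WE scalerA mulrC -scalerA -scalemxAr; congr (_ *: _).
    rewrite -rmul_mxMn // -rmul_mxM //; apply: rmul_mx_mod => //.
      exact: (idealizerMn mM).
    exact: idealizerM.
  have Xf : X f = nu%:R *: (\sum_i (s%:R * (mcoord bspan q 0 i / nu%:R) - (v i)%:~R) *:
      X (b i)).
    have [qO' vO'] := (idealizerMn mM s qO, idealizerMn mM nu bvO).
    rewrite /X rmul_mxB //.
    rewrite !rmul_mxMn // rmul_mx_sum // rmul_mx_coord // !scaler_sumr -sumrB.
    apply: eq_bigr => i _; rewrite !scalerA -scalerBl; congr (_ *: _).
    by rewrite mulrBr [in RHS]mulrCA [nu%:R * (_ / _)]mulrC divfK.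
  have detW z2 : \det (map_mx intr (W z2) : 'M[rat]_e) = (\det (W z2))%:~R.
    by rewrite det_map_mx.
  (* Strict decrease needs this: a zero determinant would put [p] in [N]. *)
  have Wz0 : 0 < `|(\det (W z))%:~R : rat|.
    rewrite normr_gt0 -detW -WE; apply/eqP; rewrite detZ => /eqP.
    rewrite mulf_eq0 expf_eq0 pnatr_eq0 (gtn_eqF E0) andbF /= => /eqP.
    move/(rmul_mx_det mM bO bfree (cO z)) => mc; apply: Nz.
    apply: (goodS NG (mu := D)); first by rewrite /mult D0.
    by apply: (goodBr NG (yc z)); apply/y0m.
  have := congr1 (fun x => `|\det x|) H3; rewrite /= Xf -scalemxAl !detZ det_mulmx.
  move/eqP; rewrite !normrM (inj_eq (mulfI _)) ?normr_eq0 ?expf_neq0 // !detW => /eqP EW.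
  have := kmin `|\det (W z')|%N; rewrite -zk leqNgt => /implyP/negP; apply.
  apply/negP; rewrite negb_imply negbK; apply/andP; split.
    by apply/asboolP; exists z'.
  rewrite -ltz_nat !abszE -(ltr_int rat) !intr_norm EW gtr_pMl //.
exists p; split=> // t.
have [|s [r [/andP[s0' sM] H]]] := step (g t *+ nu1).
  have := gm t _ one; rewrite scalerBl -scalerMnl scale1r scaler_suml => /Lmod; apply.
  by apply: (Lsum) => i; rewrite -scalerMzl; apply: (LMz); apply: (Lh (i, t)).
have /dvdnP[k kE] : (s %| M`!)%N by rewrite dvdn_fact // s0' sM.
exists (r *+ k); rewrite kE [(k * s)%N]mulnC mulnA !mulrnA -scalerMnl -mulrnBl.
exact: (goodMn NG).
Qed.
End JordanZassenhaus.

Lemma uniform_multiple (T : finType) (Q : T -> nat -> Prop) :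
  (forall t, exists k, (0 < k)%N /\ Q t k) ->
  (forall t k c, (0 < c)%N -> Q t k -> Q t (k * c)%N) ->
  exists k, (0 < k)%N /\ forall t, Q t k.
Proof.
move=> /choice[f fQ] Qmul; exists (\prod_t f t)%N; split.
  by apply: prodn_gt0 => t; case: (fQ t).
move=> t; rewrite (bigD1 t) //=; apply: Qmul; last by case: (fQ t).
by rewrite prodn_cond_gt0 // => u _; case: (fQ u).
Qed.

Lemma local_frame_exists (A : pzRingType) (d l : nat) (m : 'I_l -> set A^o)
    (a : 'I_l -> A) (mu : nat) :
  (forall k (c : 'I_k -> A), (d < k)%N ->
     exists z : 'I_k -> int, (exists i, z i <> 0) /\ \sum_i c i *~ z i = 0) ->
  crt_family true 0 m a mu ->
  exists e, (0 < e)%N /\ forall (P : lmodType A) (N : set P), dual_basis P ->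
    maxgood true 0 N -> exists i p, local_frame m e N i p.
Proof.
move=> rank_le fam; have mM := crt_max fam; have mG i := maxgood_good (mM i).
(* Right multiplication by [z] embeds A modulo the second ideal into A modulo the first; [kap]
   inverts one such embedding up to a multiple that depends on the ideals only. *)
pose linked (ic : 'I_l * 'I_l) z := forall r : A, m ic.1 (r * z) <-> m ic.2 r.
have [|ic k c c0 H|kap [kap0 kapP]] := @uniform_multiple ('I_l * 'I_l)%type
    (fun ic k => (exists z, linked ic z) ->
       exists z w : A, linked ic z /\ m ic.1 (k%:R - w * z)).
- move=> ic; have [[z zP]|h] := pselect (exists z, linked ic z); last by exists 1%N.
  have [_ _ mmax] := mM ic.1; have [|k [w [/andP[k0 _] kP]]] := mmax z 1.
    by move=> mz; apply: (maxgood1 (mM ic.2)); apply/zP; rewrite mul1r.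
  by exists k; split=> // _; exists z, w.
- move=> /H[z [w [zP zw]]]; exists z, (w *+ c); split=> //.
  by have := goodMn (mG ic.1) c zw; rewrite mulrnBl -mulrnA mulrnAl.
have [c|c k k' k'0 H P N y0 NM y0m T g gm|e [e0 eP]] := @uniform_multiple 'I_l
    (fun c k => forall (P : lmodType A) (N : set P) (y0 : P), maxgood true 0 N ->
      (forall r : A, N (r *: y0) <-> m c r) ->
      forall T (g : 'I_T -> P), (forall t (r : A), m c r -> N (r *: g t)) ->
      exists p, (forall r : A, N (r *: p) <-> m c r) /\
      forall t, exists r : A, N (g t *+ k - r *: p)).
- exact: (cyclic_multiple rank_le (mM c)).
- have [p [pm pP]] := H P N y0 NM y0m T g gm; exists p; split=> // t.
  have [r rP] := pP t; exists (r *+ k').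
  by have := goodMn (maxgood_good NM) k' rP; rewrite mulrnBl -mulrnA scalerMnl.
(* [mu] splits a generator into the parts [a i *: x s], [kap] moves each part into the span of a
   vector killed by [m c], and [e] comes from [cyclic_multiple]. *)
exists (mu * (kap * e))%N; split.
  by have /andP[mu0 _] := crt_mu fam; rewrite !muln_gt0 mu0 kap0 e0.
move=> P N [n [x [xi xE]]] NM; have NG := maxgood_good NM.
have [_ [z0 Nz0] Nmax] := NM.
have [c Nc] := family_component fam NM Nz0.
have y0m := family_colon fam NM Nc; set y0 := a c *: z0 in Nc y0m.
pose y (is_ : 'I_l * 'I_n) := a is_.1 *: x is_.2.
have /choice[g gP] is_ : exists g : P, (forall r : A, m c r -> N (r *: g)) /\
    exists w : A, N (y is_ *+ kap - w *: g).
  have [Ny|Ny] := pselect (N (y is_)).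
    exists 0; split=> [r _|]; first by rewrite scaler0; apply: (good0 NG).
    by exists 0; rewrite scaler0 subr0; apply: (goodMn NG).
  have ym := family_colon fam NM Ny.
  have [nu [s [mnu sP]]] := Nmax _ y0 Ny.
  have [|z [w [zP zw]]] := kapP (is_.1, c).
    exists s => r; rewrite -ym -y0m -scalerA.
    have E := goodZ NG r sP; rewrite scalerBr -scalerMnr in E.
    split=> H; last by apply: (goodBl NG E); apply: (goodMn NG).
    by apply: (goodS NG mnu); apply: (goodBr NG E).
  exists (z *: y is_); split=> [r mr|]; first by rewrite scalerA; apply/ym/zP.
  exists w; have := (ym _).2 zw; rewrite scalerBl -scalerA.
  by rewrite -scalerMnl scale1r.
have [|p [pm pP]] := eP c P N y0 NM y0m #|{: 'I_l * 'I_n}|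
    (fun t => g (enum_val t)).
  by move=> t; case: (gP (enum_val t)).
exists c, p; split=> // q.
have comp is_ : exists r : A, N (y is_ *+ (kap * e) - r *: p).
  have [_ [w wP]] := gP is_; have [r rP] := pP (enum_rank is_).
  rewrite enum_rankK in rP; exists (w * r).
  have := goodD NG (goodMn NG e wP) (goodZ NG w rP).
  by rewrite scalerBr mulrnBl -mulrnA -scalerMnr addrA subrK scalerA.
have /choice[r rP] s : exists r : A, N (x s *+ (mu * (kap * e)) - r *: p).
  have [r rP] := choice (fun i => comp (i, s)); exists (\sum_i r i).
  have := goodB NG (good_sum NG (P := predT) (fun i _ => rP i))
    (goodMn NG (kap * e) (family_sum fam (x s) NM)).
  rewrite sumrB -(scaler_suml p) mulrnBl sumrMnl -mulrnA opprB addrC addrA.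
  by rewrite -[X in _ - X + _]/((\sum_i y (i, s)) *+ (kap * e)) subrK.
exists (\sum_s xi s q * r s).
rewrite {1}(xE q) -sumrMnl scaler_suml -sumrB; apply: (good_sum NG) => s _.
by rewrite -scalerA scalerMnr -scalerBr; apply: (goodZ NG).
Qed.

(** * Q-finite rings *)

Record finite_rank (A : pzRingType) (d n : nat) (T : seq A) : Prop := FiniteRank {
  rank_relation : forall k (a : 'I_k -> A), (d < k)%N ->
    exists z : 'I_k -> int, (exists i, z i <> 0) /\ \sum_i a i *~ z i = 0;
  exponent_gt0 : (0 < n)%N;
  torsion_exponent : forall (a : A) nu, (0 < nu)%N -> a *+ nu = 0 -> a *+ n = 0;
  torsion_finite : forall a : A, a *+ n = 0 -> a \in T }.

Lemma Q_finite_rank (R : pzRingType) : Q_finite R ->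
  exists d n (T : seq R^c), finite_rank d n T.
Proof.
move=> [V [t [[[tB _] _] _ /finite_seqP[s sE]]]].
pose f : {additive R -> V} := HB.pack (t^~ 1) (GRing.isZmodMorphism.Build R V (t^~ 1) (tB 1)).
have fs (a : R) : f a = 0 <-> a \in s.
  by have := congr1 (fun S : set R => S a) sE; rewrite /= => ->.
have [|i k c c0 h|n [n0 nP]] := @uniform_multiple 'I_(size s) (fun i k => s`_i *+ k = 0).
- move=> i; have fsk k : s`_i *+ k \in s.
    by apply/fs; rewrite raddfMn (fs _).2 ?mul0rn // mem_nth.
  have /choice[c cP] k : exists j : 'I_(size s), s`_i *+ k = s`_j.
    have h : (index (s`_i *+ k) s < size s)%N by rewrite index_mem.
    by exists (Ordinal h); rewrite /= nth_index.
  have [j [k [jk E]]] := nat_pigeonhole c.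
  exists (k - j)%N; split; first by rewrite subn_gt0.
  by rewrite mulrnBr ?(ltnW jk) // !cP E subrr.
- by rewrite mulrnA h mul0rn.
have sn (a : R) : a \in s -> a *+ n = 0.
  by move=> sa; rewrite -(nth_index 0 sa); apply: (nP (Ordinal (etrans (index_mem a s) sa))).
have tors (a : R) nu : (0 < nu)%N -> a *+ nu = 0 -> a \in s.
  move=> nu0 h; apply/fs; have := raddfMn f nu a; rewrite h raddf0 => /esym/eqP.
  by rewrite -scaler_nat scaler_eq0 Num.Theory.pnatr_eq0 (gtn_eqF nu0) => /eqP.
exists (\dim {:V}), n, s; split=> //.
- move=> k a dk; pose v := [tuple f (a i) | i < k].
  have /freeP nfree : ~~ free v.
    apply/negP; rewrite /free size_tuple => /eqP E.
    by have := dimvS (subvf <<v>>%VS); rewrite E leqNgt dk.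
  have [c /not_implyP[c0 /existsNP[i ci]]] : exists c : 'I_k -> rat,
      ~ (\sum_(i < k) c i *: v`_i = 0 -> forall i, c i = 0).
    by apply/existsNP.
  have [D [z [D0 zE]]] := common_denominator c.
  (* Clearing denominators puts the combination in the kernel of R -> V, which [n] annihilates. *)
  exists (fun i => z i * n%:Z); split.
    exists i => /eqP; rewrite mulf_eq0 eqz_nat (gtn_eqF n0) orbF => /eqP zi.
    apply: ci; have /eqP := zE i; rewrite zi mulf_eq0 Num.Theory.pnatr_eq0.
    by rewrite (gtn_eqF D0) => /eqP.
  have : (\sum_i (a i : R) *~ z i) \in s.
    apply/fs; transitivity (D%:R *: \sum_(i < k) c i *: v`_i); last first.
      by rewrite c0 scaler0.
    rewrite raddf_sum scaler_sumr; apply: eq_bigr => j _.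
    by rewrite scalerA zE -tnth_nth tnth_mktuple scaler_int raddfMz.
  move/sn; rewrite -sumrMnl => E; rewrite -[RHS]E.
  by apply: eq_bigr => j _; rewrite mulrzA -pmulrn.
- by move=> a nu nu0 /(tors _ _ nu0); apply: sn.
- by move=> a /(tors _ _ n0).
Qed.

Section FiniteRank.
Variables (A : pzRingType) (d n : nat) (T : seq A).
Hypothesis fr : finite_rank d n T.

Definition residues (mu : nat) : Prop := exists (X : finType) (f : X -> A),
  forall x, exists i y, x = f i + y *+ mu.

Let tors (a : A) := exists2 nu, (0 < nu)%N & a *+ nu = 0.

Let torsT a : tors a -> a \in T.
Proof.
by move=> [nu nu0 h]; apply: (torsion_finite fr); apply: (torsion_exponent fr nu0).
Qed.

Let torsD a c : tors a -> tors c -> tors (a + c).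
Proof.
move=> [nu nu0 ha] [k k0 hc]; exists (nu * k)%N; first by rewrite muln_gt0 nu0.
by rewrite mulrnDl mulrnA ha mul0rn mulnC mulrnA hc mul0rn addr0.
Qed.

Let torsMz a z : tors a -> tors (a *~ z).
Proof.
by move=> [nu nu0 ha]; exists nu => //; rewrite pmulrn mulrzAC -pmulrn ha mul0rz.
Qed.

Let tors0 : tors 0. Proof. by exists 1%N. Qed.

(** At most [d] elements are independent modulo pA + torsion: independence makes the coefficients of
    an integral relation divisible by [p], the divided relation holds up to torsion, and repeating
    this contradicts a nonzero coefficient. *)
Lemma residues_prime p : prime p -> residues p.
Proof.
move=> pp; have p0 := prime_gt0 pp.
pose S a := exists c t, tors t /\ a = c *~ p%:Z + t.
have SD a c : S a -> S c -> S (a + c).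
  move=> [a' [t [tt ->]]] [c' [t' [tt' ->]]]; exists (a' + c'), (t + t').
  by split; [apply: torsD|rewrite mulrzDl addrACA].
have SMz a z : S a -> S (a *~ z).
  move=> [a' [t [tt ->]]]; exists (a' *~ z), (t *~ z).
  by split; [apply: torsMz|rewrite mulrzDl mulrzAC].
have Sp a : S (a *~ p%:Z) by exists a, 0; rewrite addr0.
pose free k := exists x : 'I_k -> A, forall z : 'I_k -> int,
  S (\sum_i x i *~ z i) -> forall i, (p%:Z %| z i)%Z.
have free0 : exists k, `[< free k >].
  by exists 0%N; apply/asboolP; exists (fun=> 0) => ? _ [].
have free_le k : `[< free k >] -> (k <= d)%N.
  move=> /asboolP[x xf]; rewrite leqNgt; apply/negP => dk.
  have [z [[i zi] z0]] := rank_relation fr x dk.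
  have divk j : exists z' : 'I_k -> int, (forall i, z i = z' i * (p ^ j)%N%:Z) /\
      tors (\sum_i x i *~ z' i).
    elim: j => [|j [z' [zz' tz']]].
      by exists z; rewrite z0; split=> // i'; rewrite expn0 mulr1.
    have /xf pz' : S (\sum_i x i *~ z' i).
      by exists 0, (\sum_i x i *~ z' i); rewrite mul0rz add0r.
    exists (fun i => z' i %/ p%:Z)%Z; split.
      by move=> i'; rewrite zz' expnS PoszM mulrA divzK.
    case: tz' => nu nu0 h; exists (p * nu)%N; first by rewrite muln_gt0 p0.
    rewrite mulrnA -sumrMnl -[RHS]h; congr (_ *+ _); apply: eq_bigr => i' _.
    by rewrite pmulrn -mulrzA divzK.
  have [z' [zz' _]] := divk `|z i|%N.
  have : (p ^ `|z i| %| `|z i|)%N by rewrite {2}zz' abszM dvdn_mull.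
  move/dvdn_leq; rewrite absz_gt0 => /(_ _)/wrap[|].
    exact/eqP.
  by rewrite leqNgt ltn_expl // prime_gt1.
have [e /asboolP[x xf] emax] := ex_maxnP free0 free_le.
have span c : exists z : 'I_e -> int, S (c - \sum_i x i *~ z i).
  pose x' (i : 'I_e.+1) := oapp x c (unlift ord0 i).
  have [z [Sz [i pzi]]] : exists z : 'I_e.+1 -> int, S (\sum_i x' i *~ z i) /\
      exists i, ~ (p%:Z %| z i)%Z.
    apply: contrapT => h; suff : (e.+1 <= e)%N by rewrite ltnn.
    apply: emax; apply/asboolP; exists x' => z Sz i; apply: contrapT => pzi.
    by apply: h; exists z; split=> //; exists i.
  move: Sz; rewrite big_ord_recl /x' unlift_none /=.
  under eq_bigr do rewrite liftK /=.
  move=> Sz; have pz0 : ~~ (p%:Z %| z ord0)%Z.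
    apply/negP => /dvdzP[q qE]; apply: pzi; case: (unliftP ord0 i) => [j|] ->; last first.
      by apply/dvdzP; exists q.
    apply: (xf (fun j => z (lift ord0 j))).
    have := SD _ _ Sz (Sp (c *~ (- q))); rewrite qE -mulrzA mulNr mulrNz.
    by rewrite addrAC subrr add0r.
  have /coprimezP[[u v] /= uv] : coprimez (z ord0) p%:Z.
    by rewrite coprimez_sym coprimezE prime_coprime //; move: pz0; rewrite dvdzE.
  exists (fun j => - (z (lift ord0 j) * u)).
  under eq_bigr do rewrite mulrNz.
  rewrite sumrN opprK.
  have := SD _ _ (SMz _ u Sz) (SMz _ v (Sp c)).
  rewrite mulrzDl addrAC -!mulrzA -mulrzDr [z ord0 * u]mulrC [p%:Z * v]mulrC uv.
  by rewrite mulrz_suml; congr (S (_ + _)); apply: eq_bigr => j _; rewrite mulrzA.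
exists ({ffun 'I_e -> 'I_p} * 'I_(size T))%type,
  (fun u : {ffun 'I_e -> 'I_p} * 'I_(size T) => \sum_i x i *+ u.1 i + T`_(u.2)) => c.
have [z [y [t [/torsT tT E]]]] := span c.
have zp i : (`|z i %% p|%Z < p)%N.
  by rewrite -ltz_nat gez0_abs ?modz_ge0 ?ltz_pmod // eqz_nat (gtn_eqF p0).
exists ([ffun i => Ordinal (zp i)], Ordinal (etrans (index_mem t T) tT)).
exists (y + \sum_i x i *~ (z i %/ p%:Z)%Z) => /=; rewrite nth_index //.
have {1}-> : c = \sum_i x i *~ z i + (y *~ p%:Z + t) by rewrite -E addrC subrK.
have -> : \sum_i x i *~ z i = \sum_i x i *+ [ffun i => Ordinal (zp i)] i +
    (\sum_i x i *~ (z i %/ p%:Z)%Z) *+ p.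
  rewrite -sumrMnl -big_split; apply: eq_bigr => i _ /=; rewrite ffunE /=.
  rewrite !pmulrn gez0_abs ?modz_ge0 // ?eqz_nat ?(gtn_eqF p0) //.
  by rewrite -mulrzA -mulrzDr addrC -divz_eq.
by rewrite mulrnDl -!addrA; congr (_ + _); rewrite addrCA addrA addrC.
Qed.

Lemma residues_gt0 mu : (0 < mu)%N -> residues mu.
Proof.
elim/ltn_ind: mu => mu IH mu0.
have [mu1|mu1] := leqP mu 1.
  have -> : mu = 1%N by apply/eqP; rewrite eqn_leq mu1.
  by exists unit, (fun=> 0) => x; exists tt, x; rewrite add0r.
have pp := pdiv_prime mu1; have /dvdnP[k kE] := pdiv_dvd mu.
have k0 : (0 < k)%N by move: mu0; rewrite kE; case: (k).
have [|//|X [f fP]] := IH k; first by rewrite [X in (_ < X)%N]kE ltn_Pmulr // prime_gt1.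
have [Y [g gP]] := residues_prime pp.
exists (X * Y)%type, (fun u => g u.2 + f u.1 *+ pdiv mu) => x.
have [j [y ->]] := gP x; have [i [w ->]] := fP y; exists (i, j), w.
by rewrite mulrnDl addrA -mulrnA -kE.
Qed.

(** A sequence without the chain condition gives [a k] outside [m k] but in all earlier ideals. In
    an integral relation among [d + 1] of them, the first nonzero term lies in its own saturated
    ideal, a contradiction. *)
Lemma rank_crt_family : exists l m a mu, @crt_family A true 0 l m a mu.
Proof.
apply: crt_family_exists => m mm; apply: contrapT => h.
have /choice[a aP] k : exists x, (forall j, (j < k)%N -> m j x) /\ ~ m k x.
  apply: contrapT => hk; apply: h; exists k => x hx; apply: contrapT => mx.
  by apply: hk; exists x.
have [z [[i zi] z0]] := rank_relation fr (fun i : 'I_d.+1 => a i) (ltnSn d).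
have [k /eqP zk kmin] := @arg_minnP _ i (fun i => z i != 0) val (introN eqP zi).
have mG := maxgood_good (mm k).
have : m k (a k *~ z k).
  have -> : a k *~ z k = 0 - \sum_(j | j != k) a j *~ z j.
    apply/eqP; rewrite sub0r -addr_eq0; apply/eqP.
    by move: z0; rewrite (bigD1 k).
  apply: (goodB mG (good0 mG)); apply: (good_sum mG) => j jk.
  have [->|zj] := eqVneq (z j) 0; first exact: good0 mG.
  apply: (goodMz mG); apply: (aP j).1; rewrite ltn_neqAle kmin // andbT.
  by rewrite eq_sym.
case: (z k) zk => q q0 h'; apply: (aP k).2.
  by apply: (goodS mG (mu := q)) h'; rewrite /mult; case: q q0.
apply: (goodS mG (mu := q.+1)) => //; have := goodN mG h'.
by rewrite NegzE mulrNz opprK.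
Qed.

(** Here two of the [a k] are congruent modulo [n], and every [m i] contains the multiples of
    [n]. *)
Lemma residue_crt_family : exists l m a mu, @crt_family A false n l m a mu.
Proof.
apply: crt_family_exists => m mm; apply: contrapT => h.
have /choice[a aP] k : exists x, (forall j, (j < k)%N -> m j x) /\ ~ m k x.
  apply: contrapT => hk; apply: h; exists k => x hx; apply: contrapT => mx.
  by apply: hk; exists x.
have [X [f fP]] := residues_gt0 (exponent_gt0 fr).
have /choice[c cP] k : exists i, exists y, a k = f i + y *+ n by apply: fP.
have [i [j [ij E]]] := nat_pigeonhole c.
have mG := maxgood_good (mm i); apply: (aP i).2.
have [[y yE] [w wE]] := (cP i, cP j).
apply: (goodBr mG) ((aP j).1 i ij); rewrite yE wE E opprD addrACA subrr add0r.
by apply: (goodB mG); apply: (good_n mG).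
Qed.

(** In an integral relation among powers of [c], split off the lowest power; the cofactor [u] is
    left invertible up to a multiplier by the first radical, so [n] kills some [c ^+ k]. Two powers
    are congruent modulo [n], and the second radical makes some [c ^+ i1] divisible by [n]. The
    product of both powers is zero. *)
Lemma common_rad_nilpotent (c : A) : good_rad true 0 c -> good_rad false n c ->
  exists s, c ^+ s = 0.
Proof.
move=> rc rc'.
have [z [[i zi] z0]] := rank_relation fr (fun i : 'I_d.+1 => c ^+ i) (ltnSn d).
have [k /eqP zk kmin] := @arg_minnP _ i (fun i => z i != 0) val (introN eqP zi).
pose w := \sum_(j < d.+1 | j != k) c ^+ (j - k.+1) *~ z j.
pose u := (z k)%:~R + w * c.
have uk : u * c ^+ k = 0.
  apply: etrans _ z0; rewrite [in RHS](bigD1 k) //= mulrDl mulrzl; congr (_ + _).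
  rewrite -mulrA mulr_suml; apply: eq_bigr => j jk.
  have [->|zj] := eqVneq (z j) 0; first by rewrite mul0r.
  have kj : (k < j)%N by rewrite ltn_neqAle kmin // andbT eq_sym.
  by rewrite mulrzAl -exprS -exprD subnK.
have [m mm mu|mu [a [y [/andP[mu0 _] E]]]] := @unit_modulo A true 0 u.
  have mG := maxgood_good mm.
  have mz : m (z k)%:~R.
    apply: (goodBr mG (y := - (w * c))); first by rewrite opprK.
    by apply: (goodN mG); apply: (goodZ mG (w : A)); apply: rc.
  case: (z k) zk mz => q q0 mz.
    by apply: (maxgood_mu mm (mu := q)) => //; rewrite /mult; case: q q0 {mz}.
  apply: (maxgood_mu mm (mu := q.+1)) => //; have := goodN mG mz.
  by rewrite NegzE mulrNz opprK.
have ck : c ^+ k *+ n = 0.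
  apply: (torsion_exponent fr mu0).
  by rewrite -mulr_natl E mulr0n addr0 -mulrA uk mulr0.
have [X [f fP]] := residues_gt0 (exponent_gt0 fr).
have /choice[h hP] j : exists i, exists y, c ^+ j = f i + y *+ n by apply: fP.
have [i1 [j1 [ij Eh]]] := nat_pigeonhole h.
have [v vE] : exists v, c ^+ i1 = v *+ n.
  have [[y1 y1E] [y2 y2E]] := (hP i1, hP j1).
  have E1 : (1 - c ^+ (j1 - i1)) * c ^+ i1 = (y1 - y2) *+ n.
    rewrite mulrBl mul1r -exprD (subnK (ltnW ij)) y1E y2E Eh opprD addrACA subrr.
    by rewrite add0r mulrnBl.
  have [m mm m1|mu' [a' [w' [mmu' E']]]] := @unit_modulo A false n (1 - c ^+ (j1 - i1)).
    have mG := maxgood_good mm; apply: (maxgood1 mm); apply: (goodBr mG m1).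
    rewrite -(prednK (n := j1 - i1)) ?subn_gt0 // exprSr.
    by apply: (goodZ mG (_ : A)); apply: rc'.
  move: mmu' E'; rewrite /mult /= => /andP[_ /eqP->] E'.
  exists (a' * (y1 - y2) + w' * c ^+ i1).
  rewrite mulr1n in E'; rewrite -[LHS]mul1r E' mulrDl -mulrA E1 mulrnAr mulrnAl.
  by rewrite mulrnDl.
by exists (k + i1)%N; rewrite exprD vE mulrnAr -mulrnAl ck mul0r.
Qed.
End FiniteRank.

Lemma nilpotent_unit (A : pzRingType) (c : A) s : c ^+ s = 0 ->
  exists d, d * (1 - c) = 1.
Proof.
move=> cs; exists (\sum_(i < s) c ^+ i).
suff -> : (\sum_(i < s) c ^+ i) * (1 - c) = 1 - c ^+ s by rewrite cs subr0.
elim: s {cs} => [|s IH]; first by rewrite big_ord0 mul0r expr0 subrr.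
by rewrite big_ord_recr mulrDl IH mulrBr mulr1 -exprSr addrA subrK.
Qed.

Section QFinite.
Variables (A : pzRingType) (d n : nat) (T : seq A).
Hypothesis fr : finite_rank d n T.

Lemma finite_rank_isomorphic (P : nat -> lmodType A) :
  (forall i, dual_basis (P i)) ->
  (forall i, exists rho : A -> {linear P i -> P i}, end_action rho) ->
  exists i j, (i < j)%N /\ isomorphic (P i) (P j).
Proof.
move=> dP eP.
have [l1 [m1 [a1 [mu1 fam1]]]] := rank_crt_family fr.
have [l2 [m2 [a2 [mu2 fam2]]]] := residue_crt_family fr.
have mu21 : mu2 = 1%N by have := crt_mu fam2; rewrite /mult /= => /andP[_ /eqP].
have [e [e0 eP1]] := local_frame_exists (rank_relation fr) fam1.
have [rho rhoP] : exists rho : forall i, A -> {linear P i -> P i},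
    forall i, end_action (rho i).
  by exists (fun i => projT1 (cid (eP i))) => i; case: cid.
pose I := ('I_l1 + 'I_l2)%type.
pose bI (k : I) := if k is inl _ then true else false.
pose nI (k : I) := if k is inl _ then 0%N else n.
pose eI (k : I) := if k is inl _ then (e * mu1)%N else 1%N.
pose m (k : I) := match k with inl i => m1 i | inr i => m2 i end.
pose N s (k : I) := transfer (rhoP s) (m k).
have mI k : maxgood (bI k) (nI k) (m k).
  by case: k => k; [apply: (crt_max fam1)|apply: (crt_max fam2)].
have mG k := maxgood_good (mI k).
have NG s k : good (bI k) (nI k) (N s k) by apply: transfer_good.
have eI_mult k : mult (bI k) (eI k).
  case: k => k; last exact: mult1.
  by apply: multM (crt_mu fam1); rewrite /mult e0.
have frames s : exists (c : {ffun I -> I}) p,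
    (forall k j : 'I_l1, k != j -> N s (inl j) (p (inl k))) /\
    framed bI nI eI (fun k => m (c k)) (N s) p.
  have [|c1 [p1 [F1 F2 F3]]] := frame_exists fam1 (rhoP := rhoP s) (e := e).
    by move=> k; apply: eP1 => //; apply: (transfer_maxgood (rhoP s) (dP s) (mI (inl k))).
  have [|c2 [p2 [_ G2 G3]]] := frame_exists fam2 (rhoP := rhoP s) (e := 1).
    move=> k; apply: (local_frame1 fam2) => //.
    exact: (transfer_maxgood (rhoP s) (dP s) (mI (inr k))).
  exists [ffun k => match k with inl i => inl (c1 i) | inr i => inr (c2 i) end],
    (fun k : I => match k with inl i => p1 i | inr i => p2 i end).
  split=> //; split.
  - exact: NG.
  - pose J (c : A) := good_rad true 0 c /\ good_rad false n c.
    have J_mull (x y : A) : J y -> J (x * y).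
      by move=> [h h']; split; apply: rad_mull.
    have J_unit (c : A) : J c -> exists d, d * (1 - c) = 1.
      by move=> [h h']; have [t /nilpotent_unit] := common_rad_nilpotent fr h h'.
    have mJ (c : A) : (forall k, m k c) -> J c.
      move=> h; split; [apply: (crt_rad fam1) => i|apply: (crt_rad fam2) => i].
        exact: (h (inl i)).
      exact: (h (inr i)).
    by move=> v; apply: (small_endo J_mull J_unit (dP s) mG mJ).
  - by case=> k r; rewrite ffunE; [apply: F2|apply: G2].
  - move=> x; have [[r rP] [r' rP']] := (F3 x, G3 x).
    exists (fun k : I => match k with inl i => r i | inr i => r' i end).
    by case=> k; [apply: rP|have := rP' k; rewrite mu21].
have {frames}[u uP] : exists u : forall s, {ffun I -> I} * (I -> P s), forall s,
    (forall k j : 'I_l1, k != j -> N s (inl j) ((u s).2 (inl k))) /\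
    framed bI nI eI (fun k => m ((u s).1 k)) (N s) (u s).2.
  have h s : exists u : {ffun I -> I} * (I -> P s),
      (forall k j : 'I_l1, k != j -> N s (inl j) (u.2 (inl k))) /\
      framed bI nI eI (fun k => m (u.1 k)) (N s) u.2.
    by have [c [p h]] := frames s; exists (c, p).
  by exists (fun s => projT1 (cid (h s))) => s; case: cid.
pose E := (e * mu1)%N.
have E0 : (0 < n * E)%N.
  rewrite !muln_gt0 (exponent_gt0 fr) e0.
  by have /andP[] := crt_mu fam1.
(* Adding [S *+ n] to [x] shifts the coordinates at the saturated places by [n * E] times [y]; the
   other places do not see multiples of [n]. *)
have shift s (r r' y : I -> A) : (forall k, r' k = r k + y k *+ (n * E)) ->
    coords eI (N s) (u s).2 r -> coords eI (N s) (u s).2 r'.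
  move=> r'E [x xP]; set p := (u s).2 in xP *.
  pose S := \sum_(k < l1) y (inl k) *: p (inl k).
  exists (x + S *+ n) => k; rewrite r'E mulrnDl scalerDl opprD addrACA.
  apply: (goodD (NG s k) (xP k)); case: k => k /=.
    rewrite -mulrnA -scalerMnl -mulrnBl; apply: (goodMn (NG s (inl k))).
    rewrite /S (bigD1 k) //= addrAC subrr add0r.
    apply: (good_sum (NG s (inl k))) => j jk; apply: (goodZ (NG s (inl k))).
    exact: (uP s).1.
  rewrite mulr1n mulnC mulrnA -scalerMnl -mulrnBl.
  exact: (good_n (NG s (inr k))).
have [X [f fP]] := residues_gt0 fr E0.
have /choice[q qP] a : exists qy : X * A, a = f qy.1 + qy.2 *+ (n * E).
  by have [i [y h]] := fP a; exists (i, y).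
have coordsE s r : coords eI (N s) (u s).2 r <->
    coords eI (N s) (u s).2 (fun k => f ([ffun k => (q (r k)).1] k)).
  split; last by apply: shift => k; rewrite ffunE; apply: qP.
  apply: (shift s r _ (fun k => - (q (r k)).2)) => k; rewrite ffunE.
  by rewrite [X in X + _]qP -addrA -mulrnDl subrr mul0rn addr0.
(* A complete invariant with finitely many values: the types of the frame vectors and the coordinate
   tuples modulo [n * E]. *)
pose inv s : {ffun I -> I} * {set {ffun I -> X}} :=
  ((u s).1, [set phi : {ffun I -> X} |
    `[< coords eI (N s) (u s).2 (fun k => f (phi k)) >]]%SET).
have [i [j [ij [cE /setP sE]]]] := nat_pigeonhole inv.
exists i, j; split=> //; have [[_ Fi] [_ Fj]] := (uP i, uP j).
rewrite -cE in Fj; apply: (glue eI_mult (dP i) (dP j) Fi Fj) => r.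
rewrite coordsE (coordsE j); have := sE [ffun k => (q (r k)).1]; rewrite !inE.
by move=> h; split=> /asboolP; [rewrite h|rewrite -h] => /asboolP.
Qed.
End QFinite.

(** * Orbits of the duality *)

Section Isomorphic.
Variable A : pzRingType.
Implicit Types M N L : lmodType A.

Lemma isomorphic_refl M : isomorphic M M.
Proof. by exists idfun; exists idfun. Qed.

Lemma isomorphic_sym M N : isomorphic M N -> isomorphic N M.
Proof.
case=> f [g fK gK]; have glin : linear g.
  by move=> a x y; apply: (can_inj fK); rewrite gK linearP !gK.
by exists (mklin glin); exists f.
Qed.

Lemma isomorphic_trans M N L : isomorphic M N -> isomorphic N L -> isomorphic M L.
Proof. by move=> [f fb] [g gb]; exists (g \o f); apply: bij_comp. Qed.

Lemma isomorphic_prod M N M' N' : isomorphic M M' -> isomorphic N N' ->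
  isomorphic (M * N)%type (M' * N')%type.
Proof.
move=> [f [f' fK f'K]] [g [g' gK g'K]].
have l : linear (fun x : M * N => (f x.1, g x.2)).
  by move=> a x y; apply: injective_projections; rewrite /= linearP.
exists (mklin l); exists (fun x => (f' x.1, g' x.2)) => -[x y] /=.
  by rewrite fK gK.
by rewrite f'K g'K.
Qed.

Lemma isomorphic_prodC M N : isomorphic (M * N)%type (N * M)%type.
Proof.
have l : linear (fun x : M * N => (x.2, x.1)) by [].
by exists (mklin l); exists (fun x => (x.2, x.1)) => -[].
Qed.

Lemma isomorphic_prodA M N L : isomorphic (M * (N * L))%type ((M * N) * L)%type.
Proof.
have l : linear (fun x : M * (N * L) => ((x.1, x.2.1), x.2.2)) by [].
by exists (mklin l); exists (fun x => (x.1.1, (x.1.2, x.2))) => [[x [y z]]|[[x y] z]].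
Qed.

Lemma dual_basis_prod M N : dual_basis M -> dual_basis N -> dual_basis (M * N)%type.
Proof.
move=> [k [x [xi xE]]] [l [y [eta yE]]].
have f1 (h : {linear M -> A^o}) : linear (fun u : M * N => h u.1).
  by move=> a u v; rewrite -linearP.
have f2 (h : {linear N -> A^o}) : linear (fun u : M * N => h u.2).
  by move=> a u v; rewrite -linearP.
apply: (@dual_basis_fin A (M * N)%type ('I_k + 'I_l)%type
  (fun i => match i with inl i => (x i, 0) | inr i => (0, y i) end)
  (fun i => match i with inl i => mklin (f1 (xi i)) | inr i => mklin (f2 (eta i)) end)).
move=> [u v]; rewrite big_sumType /=; apply: injective_projections => /=.
  rewrite !(raddf_sum fst) /= [X in _ + X]big1 => [|i _]; last by rewrite scaler0.
  by rewrite addr0; apply: xE.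
rewrite !(raddf_sum snd) /= [X in X + _]big1 => [|i _]; last by rewrite scaler0.
by rewrite add0r; apply: yE.
Qed.

Lemma unit_trace_prod M N : unit_trace M -> unit_trace (M * N)%type.
Proof.
move=> [k [x [xi xE]]]; have f1 (h : {linear M -> A^o}) : linear (fun u : M * N => h u.1).
  by move=> a u v; rewrite -linearP.
by exists k, (fun i => (x i, 0)), (fun i => mklin (f1 (xi i))).
Qed.

Lemma dual_basis_regular : dual_basis A^o.
Proof.
exists 1%N, (fun=> 1), (fun=> idfun) => p.
by rewrite big_ord1; apply: esym (mulr1 (p : A)).
Qed.

Lemma unit_trace_regular : unit_trace A^o.
Proof. by exists 1%N, (fun=> 1), (fun=> idfun); rewrite big_ord1. Qed.

Lemma end_action_regular : exists rho : A -> {linear A^o -> A^o}, end_action rho.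
Proof.
have l (c : A) : linear (fun x : A^o => (x : A) * c : A^o).
  by move=> a x y; rewrite mulrDl; congr (_ + _); rewrite -[LHS]mulrA.
exists (fun c => mklin (l c)); split=> /=.
- by move=> c e p; rewrite mulrDr.
- by move=> p; rewrite mulr1.
- by move=> c e p; rewrite mulrA.
- by move=> c e /(_ 1); rewrite !mul1r.
- move=> f; exists (f 1) => x /=.
  have E : x = (x : A) *: (1 : A^o) by rewrite -[LHS]mulr1.
  by rewrite [in LHS]E linearZ.
Qed.
End Isomorphic.

Section IteratedDual.
Variables (R : pzRingType) (P : bimodule R^c R).
Hypothesis HP : bimod_progenerator P.
Local Notation A := R^c.

Definition dualL (M : lmodType A) : lmodType A := dual P M.

(** The duality is full and faithful, and applying it twice restores the order of composition. *)
Lemma end_action_dual2 (M : lmodType A) : dual_basis M ->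
  (exists rho : A -> {linear M -> M}, end_action rho) ->
  exists rho : A -> {linear dualL (dualL M) -> dualL (dualL M)}, end_action rho.
Proof.
move=> dM [rho rhoP]; have dM' := dual_dual_basis HP dM.
exists (fun c => dual_linear P (dual_linear P (rho c))); split.
- move=> c e F; apply: linear_ext => h /=.
  rewrite -[RHS](linearD (F : {linear dual P M -> P})) /=.
  congr (F _); apply: linear_ext => x /=.
  by rewrite (end_actionD rhoP) linearD.
- move=> F; apply: linear_ext => h /=; congr (F _); apply: linear_ext => x /=.
  by rewrite (end_action1 rhoP).
- move=> c e F; apply: linear_ext => h /=; congr (F _); apply: linear_ext => x /=.
  by rewrite (end_actionM rhoP).
- move=> c e E; apply: (end_action_inj rhoP); apply: (dual_map_inj HP dM).
  exact: (dual_map_inj HP dM' E).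
- move=> G; have [g gE] := dual_full HP G dM'.
  have [f fE] := dual_full HP g dM; have [c cE] := end_action_surj rhoP f.
  exists c => F; rewrite gE; apply: linear_ext => h /=; congr (F _).
  by rewrite fE; apply: linear_ext => x /=; rewrite cE.
Qed.

Lemma iter_dual_basis k (M : lmodType A) : dual_basis M -> dual_basis (iter k dualL M).
Proof. by move=> dM; elim: k => //= k IH; apply: dual_dual_basis. Qed.

Lemma iter_unit_trace k (M : lmodType A) : unit_trace M -> unit_trace (iter k dualL M).
Proof. by move=> dM; elim: k => //= k IH; apply: dual_unit_trace. Qed.

Lemma iter_end_action k (M : lmodType A) : dual_basis M ->
  (exists rho : A -> {linear M -> M}, end_action rho) ->
  exists rho : A -> {linear iter k.*2 dualL M -> iter k.*2 dualL M}, end_action rho.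
Proof.
move=> dM eM; elim: k => //= k IH.
by apply: end_action_dual2 => //; apply: iter_dual_basis.
Qed.

(* If D^(k+1) X is isomorphic to X, then D permutes the summands of
   X + D X + ... + D^k X up to isomorphism. *)
Lemma self_dual_exists (X : lmodType A) k : dual_basis X -> unit_trace X ->
  isomorphic (iter k.+1 dualL X) X ->
  exists M : lmodType A, [/\ dual_basis M, unit_trace M & isomorphic M (dualL M)].
Proof.
move=> dX tX iX.
pose sums := fix sums k : lmodType A :=
  if k is k'.+1 then (sums k' * iter k dualL X)%type else X.
pose dsums := fix dsums k : lmodType A :=
  if k is k'.+1 then (dsums k' * iter k.+1 dualL X)%type else dualL X.
have dualS j : isomorphic (dualL (sums j)) (dsums j).
  elim: j => [|j IH]; first exact: isomorphic_refl.
  apply: isomorphic_trans (dual_prod P _ _) _.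
  by apply: isomorphic_prod => //; apply: isomorphic_refl.
have consS j : isomorphic (X * dsums j)%type (sums j.+1).
  elim: j => [|j IH]; first exact: isomorphic_refl.
  apply: isomorphic_trans (isomorphic_prodA _ _ _) _.
  by apply: isomorphic_prod => //; apply: isomorphic_refl.
have sumsD : isomorphic (dsums k) (sums k).
  case: k iX => [|k] iX; first exact: iX.
  apply: isomorphic_trans (consS k); apply: isomorphic_trans (isomorphic_prodC _ _).
  by apply: isomorphic_prod => //; apply: isomorphic_refl.
exists (sums k); split.
- elim: k {iX sumsD} => //= k IH; apply: dual_basis_prod => //.
  exact: (iter_dual_basis k.+1).
- by elim: k {iX sumsD} => //= k IH; apply: unit_trace_prod.
- by apply: isomorphic_sym; apply: isomorphic_trans (dualS k) sumsD.
Qed.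
End IteratedDual.

Lemma dual_orbit_finite (R : pzRingType) (P : nat -> lmodType R^c) :
  semilocal R \/ Q_finite R -> (forall i, dual_basis (P i)) ->
  (forall i, exists rho : R^c -> {linear P i -> P i}, end_action rho) ->
  exists i j, (i < j)%N /\ isomorphic (P i) (P j).
Proof.
case=> [sR|/Q_finite_rank[d [n [T fr]]]] dP eP; first exact: semilocal_isomorphic.
exact: (finite_rank_isomorphic fr).
Qed.

Theorem corollary5p6 (R : pzRingType) (R_fin : semilocal R \/ Q_finite R)
    (sigma : {rmorphism center R -> center R}) (sigma_bij : bijective sigma) :
  (exists S : central_alg (center R),
     morita_over (center_alg R) S /\
     exists alpha : S -> S, anti_automorphism_of_type sigma alpha) <->
  morita_of_type sigma (op_alg (center_alg R)) (center_alg R).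
Proof.
split=> [[S [RS [alpha alphaP]]]|[P PP]].
  exact: anti_automorphism_morita RS alphaP.
have HP : bimod_progenerator (P : bimodule R^c R) := PP.1.
have dA := dual_basis_regular R^c.
have tA := unit_trace_regular R^c.
have [i [j [ij iso_ij]]] := dual_orbit_finite
  (P := fun i => iter i.*2 (dualL P) (R^c)^o) R_fin
  (fun i => iter_dual_basis HP _ dA)
  (fun i => iter_end_action HP _ dA (end_action_regular R^c)).
pose X := iter i.*2 (dualL P) (R^c)^o.
(* The period in [self_dual_exists] is one more than its argument; here it is 2(j - i), the distance
   between the isomorphic modules D^(2i) R and D^(2j) R. *)
have [|M [dM tM iM]] := @self_dual_exists R P HP X (j - i).*2.-1
    (iter_dual_basis HP _ dA) (iter_unit_trace HP _ tA).
  rewrite prednK ?double_gt0 ?subn_gt0 // -iterD -doubleD subnK ?(ltnW ij) //.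
  exact: isomorphic_sym.
exists (endo_alg (R := center_alg R) tM); split.
  exact: (@endo_alg_morita _ (center_alg R) M dM tM).
exact: (endo_anti_automorphism (R := center_alg R) dM tM PP iM).
Qed.
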